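(* Let $\Theta$ be a unicritical finite Blaschke product with $\deg\Theta = n$. Then: (i) if $n\ge3$, $W(S_\Theta)$ contains a pseudohyperbolic disk of radius $\tfrac{1}{2^{1/2}}$; (ii) if $n\ge4$, $W(S_\Theta)$ contains a pseudohyperbolic disk of radius $\tfrac{1}{2^{1/3}}$.
   Context: $\mathbb{D}$ is the open unit disk and $\mathbb{T}$ the unit circle. A unicritical finite Blaschke product of degree $n\ge 1$ is a function $\Theta(z)=\lambda\left(\frac{z-z_0}{1-\bar z_0 z}\right)^n$ with $z_0\in\mathbb{D}$, $\lambda\in\mathbb{T}$. For a finite Blaschke product $\Theta$, $K_\Theta = H^2\ominus \Theta H^2$, where $H^2=H^2(\mathbb{D})$ is the Hardy space. The compression of the shift is $S_\Theta = P_\Theta M_z|_{K_\Theta}$, where $P_\Theta$ is the orthogonal projection of $H^2$ onto $K_\Theta$ and $M_z$ is multiplication by $z$. The numerical range of an operator $A$ is $W(A)=\{\langle Ax,x\rangle : \|x\|=1\}$. A pseudohyperbolic disk of radius $r\in(0,1)$ is a set of the form $D_\rho(w_0,r) = \{z\in\mathbb{D} : |\frac{z-w_0}{1-\bar w_0 z}|<r\}$ for some $w_0\in\mathbb{D}$. *)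

(* Defs.v *)
From Stdlib Require Import Reals ClassicalEpsilon.
From Coquelicot Require Import Coquelicot.
Open Scope C_scope.

Definition unit_disk (z : C) : Prop := (Cmod z < 1)%R.

Definition unit_circle (z : C) : Prop := Cmod z = 1%R.

Definition disk_automorphism (z0 z : C) : C := (z - z0) / (1 - Cconj z0 * z).

Definition unicritical_blaschke (n : nat) (Theta : C -> C) : Prop :=
  (1 <= n)%nat /\
  exists z0 lambda : C, unit_disk z0 /\ unit_circle lambda /\
    forall z : C, unit_disk z -> Theta z = lambda * disk_automorphism z0 z ^ n.

Definition pseudohyperbolic_disk (w0 : C) (r : R) (z : C) : Prop :=
  unit_disk z /\ (Cmod (disk_automorphism w0 z) < r)%R.

(* Elements of H^2 are represented by functions on C of which only the values
   on the disk matter: everything below depends on them only through their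
   Taylor coefficients at 0. *)
Definition is_taylor (f : C -> C) (a : nat -> C) : Prop :=
  forall z : C, unit_disk z -> is_pseries a z (f z).

Definition H2 (f : C -> C) : Prop :=
  exists a : nat -> C,
    is_taylor f a /\ ex_series (fun k => (Cmod (a k) ^ 2)%R).

Definition taylor (f : C -> C) : nat -> C :=
  epsilon (inhabits (fun _ : nat => RtoC 0)) (is_taylor f).

Definition CSeries (a : nat -> C) : C :=
  (Series (fun k => Re (a k)), Series (fun k => Im (a k))).

Definition H2_inner (f g : C -> C) : C :=
  CSeries (fun k => taylor f k * Cconj (taylor g k)).

Definition H2_norm (f : C -> C) : R := sqrt (Re (H2_inner f f)).

Definition mult_op (phi f : C -> C) : C -> C := fun z => phi z * f z.

Definition model_space (Theta : C -> C) (f : C -> C) : Prop :=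
  H2 f /\ forall h : C -> C, H2 h -> H2_inner f (mult_op Theta h) = 0.

(* The projection is determined by the two conditions only on the disk. *)
Definition orth_proj (K : (C -> C) -> Prop) (h : C -> C) : C -> C :=
  epsilon (inhabits h)
    (fun g => K g /\
       forall k : C -> C, K k -> H2_inner (fun z => h z - g z) k = 0).

Definition compressed_shift (Theta : C -> C) (f : C -> C) : C -> C :=
  orth_proj (model_space Theta) (mult_op (fun z => z) f).

Definition numerical_range (K : (C -> C) -> Prop) (A : (C -> C) -> C -> C)
    (w : C) : Prop :=
  exists f : C -> C, K f /\ H2_norm f = 1%R /\ w = H2_inner (A f) f.

(* Main.v *)
(* The vectors e_j = sqrt(1 - |a|^2) phi^j / (1 - conj a z), j < n, with phi the disk
   automorphism vanishing at a, form an orthonormal basis of the model space, in which the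
   compressed shift is (a + N) (1 + conj a N)^-1 for a nilpotent Jordan block N.
   Compressing to the first m = 3 or 4 vectors and rotating, one may take a in [0, 1) and
   the m x m matrix A = a + (1 - a^2) (N - a N^2 + a^2 N^3).

   The largest eigenvalue of the real part of e^{-it} A is a cos t + (1 - a^2) l / 2 with l
   the largest root of l^3 - (2 + a^2) l + 2 a x (m = 3) or of
   l^2 - (1 + a^2) l + 2 a x - 1 (m = 4), where x = cos t. If l is replaced by the affine
   function of x with the same values at x = 1 and x = -1, these polynomials become convex
   in x, hence nonpositive on [-1, 1]: W(A) contains the Euclidean disk whose diameter
   is the interval W(A) /\ R. That disk contains a pseudohyperbolic disk of the required
   radius, or of radius 4 / 5 > 2^(-1/3) if m = 4, with centre tanh (3 s / 2), where
   a = tanh s. *)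

(* The radius [2^(-1/2)] leaves no slack. At [a = 0] the 3 x 3 matrix is a nilpotent Jordan block,
   whose numerical range is the disk of radius cos (pi / 4). For small [s] both real ends of W(A)
   move by [3 s / 4] to first order, while the ends of a pseudohyperbolic disk of this radius with
   centre [k s] move by [k s / 2]. Fitting at both ends forces [k = 3 / 2], whence the centre tanh
   (3 s / 2). For m = 4 the block has numerical radius cos (pi / 5) > 4 / 5; the slack is spent on a
   rational radius, which keeps cube roots out of the polynomial inequalities.

   Containing a disk needs only a lower bound for the support function. Hence the exact largest
   eigenvalue can give way to an affine function, which avoids solving a cubic and yields trial
   vectors that are explicit and continuous in [t]. Continuity then replaces separation and
   compactness arguments.

   The projection in the definitions is chosen by [epsilon], so nothing is known about it before a
   projection is shown to exist. This is done by hand for the few shifted basis vectors that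
   occur. *)
Require Import Defs.
From Stdlib Require Import Reals Lra Lia FunctionalExtensionality ClassicalEpsilon.
From Coquelicot Require Import Coquelicot.
Open Scope C_scope.

(** * Square-summable sequences *)

Lemma C_eq (z w : C) : Re z = Re w -> Im z = Im w -> z = w.
Proof.
  destruct z, w; simpl; intros; subst; reflexivity.
Qed.

Lemma Re_sum_n (a : nat -> C) (n : nat) :
  Re (sum_n a n) = sum_n (fun k => Re (a k)) n.
Proof.
  induction n as [|n IH].
  - now rewrite !sum_O.
  - rewrite !sum_Sn, <- IH; reflexivity.
Qed.

Lemma Im_sum_n (a : nat -> C) (n : nat) :
  Im (sum_n a n) = sum_n (fun k => Im (a k)) n.
Proof.
  induction n as [|n IH].
  - now rewrite !sum_O.
  - rewrite !sum_Sn, <- IH; reflexivity.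
Qed.

Lemma is_series_C (a : nat -> C) (l : C) :
  is_series a l <->
  is_series (fun k => Re (a k)) (Re l) /\ is_series (fun k => Im (a k)) (Im l).
Proof.
  split.
  - intros H; split.
    + apply (filterlim_ext (fun n => Re (sum_n a n))); [intros n; apply Re_sum_n|].
      intros P [e He]; apply (H (fun z => P (Re z))).
      exists e; intros y [Hy _]; apply He, Hy.
    + apply (filterlim_ext (fun n => Im (sum_n a n))); [intros n; apply Im_sum_n|].
      intros P [e He]; apply (H (fun z => P (Im z))).
      exists e; intros y [_ Hy]; apply He, Hy.
  - intros [H1 H2] P [e He].
    assert (B1 : locally (Re l) (ball (Re l) e)) by apply locally_ball.
    assert (B2 : locally (Im l) (ball (Im l) e)) by apply locally_ball.
    destruct (H1 _ B1) as [N1 HN1]; destruct (H2 _ B2) as [N2 HN2].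
    exists (max N1 N2); intros n Hn.
    apply He; split.
    + change (ball (Re l) e (Re (sum_n a n))); rewrite Re_sum_n; apply HN1; lia.
    + change (ball (Im l) e (Im (sum_n a n))); rewrite Im_sum_n; apply HN2; lia.
Qed.

Lemma CSeries_unique (a : nat -> C) (l : C) : is_series a l -> CSeries a = l.
Proof.
  intros [H1 H2]%is_series_C; apply C_eq; apply is_series_unique; assumption.
Qed.

Lemma is_series_unique_C (a : nat -> C) (l m : C) :
  is_series a l -> is_series a m -> l = m.
Proof.
  intros H1 H2; rewrite <- (CSeries_unique _ _ H1); now apply CSeries_unique.
Qed.

Lemma ex_series_pos_le (a b : nat -> R) :
  (forall k, 0 <= a k <= b k)%R -> ex_series b -> ex_series a.
Proof.
  intros H Hb; refine (ex_series_le (V := R_CompleteNormedModule) _ _ _ Hb).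
  intros k; change (Rabs (a k) <= b k)%R; rewrite Rabs_pos_eq; apply H.
Qed.

Lemma CSeries_correct (a : nat -> C) :
  ex_series (fun k => Cmod (a k)) -> is_series a (CSeries a).
Proof.
  intros H; apply is_series_C; split; apply Series_correct, ex_series_Rabs;
    revert H; apply ex_series_pos_le; intros k; (split; [apply Rabs_pos|]).
  - apply re_le_Cmod.
  - exact (Rle_trans _ _ _ (Rmax_r _ _) (Rmax_Cmod (a k))).
Qed.

Lemma is_series_C_ext (a b : nat -> C) (l : C) :
  (forall k, a k = b k) -> is_series a l -> is_series b l.
Proof. exact (is_series_ext a b l). Qed.

Lemma is_series_C_decr (a : nat -> C) (l : C) :
  a O = 0 -> is_series (fun k => a (S k)) l -> is_series a l.
Proof.
  intros H0 H; apply is_series_decr_1.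
  change (plus l (opp (a O))) with (l + - a O).
  replace (l + - a O) with l by (rewrite H0; ring); exact H.
Qed.

Lemma is_series_C_plus (a b : nat -> C) (l m : C) :
  is_series a l -> is_series b m -> is_series (fun k => a k + b k) (l + m).
Proof. exact (is_series_plus a b l m). Qed.

Lemma is_series_C_scal (c : C) (a : nat -> C) (l : C) :
  is_series a l -> is_series (fun k => c * a k) (c * l).
Proof. exact (is_series_scal c a l). Qed.

Definition l2 (a : nat -> C) : Prop := ex_series (fun k => (Cmod (a k) ^ 2)%R).

Definition ip (a b : nat -> C) : C := CSeries (fun k => a k * Cconj (b k)).

Definition lin (p : C) (a : nat -> C) (q : C) (b : nat -> C) : nat -> C :=
  fun k => p * a k + q * b k.

Definition shift (a : nat -> C) : nat -> C :=
  fun k => match k with O => 0 | S k => a k end.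

Lemma l2_lin (p q : C) (a b : nat -> C) : l2 a -> l2 b -> l2 (lin p a q b).
Proof.
  intros Ha Hb.
  apply (ex_series_pos_le _ (fun k => 2 * Cmod p ^ 2 * Cmod (a k) ^ 2
                             + 2 * Cmod q ^ 2 * Cmod (b k) ^ 2)%R).
  - intros k; split; [apply pow2_ge_0|]; unfold lin.
    assert (H := Cmod_triangle (p * a k) (q * b k)); rewrite !Cmod_mult in H.
    assert (H0 := Cmod_ge_0 (p * a k + q * b k)).
    set (u := (Cmod p * Cmod (a k))%R) in *; set (v := (Cmod q * Cmod (b k))%R) in *.
    replace (2 * Cmod p ^ 2 * Cmod (a k) ^ 2 + 2 * Cmod q ^ 2 * Cmod (b k) ^ 2)%R
      with (2 * u ^ 2 + 2 * v ^ 2)%R by (unfold u, v; ring).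
    assert (0 <= (u - v) ^ 2)%R by apply pow2_ge_0.
    assert (Cmod (p * a k + q * b k) ^ 2 <= (u + v) ^ 2)%R by (apply pow_incr; lra).
    nra.
  - apply (ex_series_plus (V := R_NormedModule)); now apply (ex_series_scal (V := R_NormedModule)).
Qed.

Lemma l2_shift (a : nat -> C) : l2 a -> l2 (shift a).
Proof. intros H; apply ex_series_incr_1; exact H. Qed.

Lemma l2_mult_summable (a b : nat -> C) :
  l2 a -> l2 b -> ex_series (fun k => Cmod (a k * b k)).
Proof.
  intros Ha Hb.
  apply (ex_series_pos_le _ (fun k => Cmod (a k) ^ 2 + Cmod (b k) ^ 2)%R).
  - intros k; split; [apply Cmod_ge_0|]; rewrite Cmod_mult.
    assert (0 <= (Cmod (a k) - Cmod (b k)) ^ 2)%R by apply pow2_ge_0.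
    assert (0 <= Cmod (a k))%R by apply Cmod_ge_0.
    assert (0 <= Cmod (b k))%R by apply Cmod_ge_0.
    nra.
  - now apply (ex_series_plus (V := R_NormedModule)).
Qed.

Lemma is_series_ip (a b : nat -> C) :
  l2 a -> l2 b -> is_series (fun k => a k * Cconj (b k)) (ip a b).
Proof.
  intros Ha Hb; apply CSeries_correct, (l2_mult_summable a (fun k => Cconj (b k)) Ha).
  revert Hb; apply ex_series_ext; intros k; now rewrite Cmod_conj.
Qed.

Lemma ip_conj (a b : nat -> C) : l2 a -> l2 b -> ip b a = Cconj (ip a b).
Proof.
  intros Ha Hb; apply CSeries_unique.
  destruct (proj1 (is_series_C _ _) (is_series_ip a b Ha Hb)) as [H1 H2].
  apply is_series_C; split.
  - revert H1; apply is_series_ext; intros k; simpl; apply Rminus_diag_uniq; ring.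
  - apply (is_series_ext (fun k => opp (Im (a k * Cconj (b k))))).
    + intros k; unfold opp; simpl; apply Rminus_diag_uniq; ring.
    + exact (is_series_opp _ _ H2).
Qed.

Lemma ip_lin_l (p q : C) (a b c : nat -> C) :
  l2 a -> l2 b -> l2 c -> ip (lin p a q b) c = p * ip a c + q * ip b c.
Proof.
  intros Ha Hb Hc; apply CSeries_unique.
  apply (is_series_C_ext (fun k => p * (a k * Cconj (c k)) + q * (b k * Cconj (c k)))).
  - intros k; unfold lin; ring.
  - apply is_series_C_plus; apply is_series_C_scal; now apply is_series_ip.
Qed.

Lemma ip_lin_r (p q : C) (a b c : nat -> C) :
  l2 a -> l2 b -> l2 c ->
  ip c (lin p a q b) = Cconj p * ip c a + Cconj q * ip c b.
Proof.
  intros Ha Hb Hc.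
  rewrite (ip_conj (lin p a q b) c), ip_lin_l; try assumption.
  - now rewrite (ip_conj a c), (ip_conj b c), Cplus_conj, !Cmult_conj.
  - now apply l2_lin.
Qed.

Lemma ip_shift (a b : nat -> C) : l2 a -> l2 b -> ip (shift a) (shift b) = ip a b.
Proof.
  intros Ha Hb; apply CSeries_unique.
  apply is_series_C_decr; [simpl; ring | now apply is_series_ip].
Qed.

(** Division by [1 - b z] on Taylor coefficients, as a recursion instead of a Cauchy product with a
    geometric series. *)
Fixpoint resolvent (b : C) (h : nat -> C) (k : nat) : C :=
  match k with
  | O => h O
  | S k => h (S k) + b * resolvent b h k
  end.

Lemma resolvent_eq (b : C) (h : nat -> C) :
  h = lin 1 (resolvent b h) (- b) (shift (resolvent b h)).
Proof.
  apply functional_extensionality; intros [|k]; unfold lin; simpl; ring.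
Qed.

(** * Taylor coefficients and multiplication by a disk automorphism *)

(* Convexity of the square gives |u_{k+1}|^2 <= |h_{k+1}|^2 / (1 - |b|) + |b| |u_k|^2
   for u = resolvent b h, and this telescopes. *)
Lemma l2_resolvent (b : C) (h : nat -> C) :
  (Cmod b < 1)%R -> l2 h -> l2 (resolvent b h).
Proof.
  intros Hb Hh; set (u := resolvent b h); set (t := Cmod b).
  assert (Ht : (0 <= t < 1)%R) by (split; [apply Cmod_ge_0 | exact Hb]).
  set (g := fun k => (/ (1 - t) * Cmod (h k) ^ 2)%R).
  assert (Hg : ex_series g) by (apply (ex_series_scal (V := R_NormedModule)), Hh).
  assert (Hg0 : forall k, (0 <= g k)%R).
  { intros k; unfold g; apply Rmult_le_pos; [left; apply Rinv_0_lt_compat; lra|].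
    apply pow2_ge_0. }
  assert (step : forall k, (Cmod (u (S k)) ^ 2 <= g (S k) + t * Cmod (u k) ^ 2)%R).
  { intros k; unfold g.
    assert (H := Cmod_triangle (h (S k)) (b * u k)).
    rewrite Cmod_mult in H; fold t in H.
    change (h (S k) + b * u k) with (u (S k)) in H.
    set (A := Cmod (h (S k))) in *; set (B := Cmod (u k)) in *.
    assert (H0 : (0 <= Cmod (u (S k)))%R) by apply Cmod_ge_0.
    assert (Cmod (u (S k)) ^ 2 <= (A + t * B) ^ 2)%R by (apply pow_incr; lra).
    assert (0 <= t * (/ (1 - t) * (A - (1 - t) * B) ^ 2))%R.
    { apply Rmult_le_pos; [lra|].
      apply Rmult_le_pos; [left; apply Rinv_0_lt_compat; lra | apply pow2_ge_0]. }
    replace (/ (1 - t) * A ^ 2 + t * B ^ 2)%R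
      with ((A + t * B) ^ 2 + t * (/ (1 - t) * (A - (1 - t) * B) ^ 2))%R
      by (field; lra).
    lra. }
  assert (tele : forall n,
    ((1 - t) * sum_n (fun k => Cmod (u k) ^ 2) n + t * Cmod (u n) ^ 2 <= sum_n g n)%R).
  { induction n as [|n IH].
    - rewrite !sum_O; unfold g, u; simpl resolvent.
      assert (0 <= t * (/ (1 - t) * Cmod (h O) ^ 2))%R.
      { apply Rmult_le_pos; [lra|].
        apply Rmult_le_pos; [left; apply Rinv_0_lt_compat; lra | apply pow2_ge_0]. }
      replace (/ (1 - t) * Cmod (h O) ^ 2)%R
        with (Cmod (h O) ^ 2 + t * (/ (1 - t) * Cmod (h O) ^ 2))%R by (field; lra).
      lra.
    - rewrite !sum_Sn; specialize (step n).
      unfold plus; simpl AbelianMonoid.plus in *; simpl in *; lra. }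
  assert (bound : forall n, (sum_n g n <= Series g)%R).
  { intros n; apply (is_lim_seq_incr_compare (sum_n g)).
    - apply Series_correct, Hg.
    - intros k; rewrite sum_Sn; specialize (Hg0 (S k)).
      unfold plus; simpl; lra. }
  destruct (ex_finite_lim_seq_incr (sum_n (fun k => (Cmod (u k) ^ 2)%R))
              (/ (1 - t) * Series g)) as [l Hl].
  - intros n; rewrite sum_Sn; assert (H := pow2_ge_0 (Cmod (u (S n)))).
    unfold plus; simpl in *; lra.
  - intros n; apply (Rmult_le_reg_l (1 - t)); [lra|].
    rewrite <- Rmult_assoc, Rinv_r, Rmult_1_l by lra.
    specialize (tele n); specialize (bound n).
    assert (0 <= t * Cmod (u n) ^ 2)%R
      by (apply Rmult_le_pos; [lra | apply pow2_ge_0]).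
    lra.
  - exists l; exact Hl.
Qed.

Lemma is_taylor_series (f : C -> C) (a : nat -> C) :
  is_taylor f a <->
  forall z, unit_disk z -> is_series (fun k => z ^ k * a k) (f z).
Proof.
  split; intros H z Hz; generalize (H z Hz).
  - apply is_series_ext; intros k; reflexivity.
  - apply is_series_ext; intros k; reflexivity.
Qed.

Lemma l2_geom (z : C) : unit_disk z -> l2 (fun k => z ^ k).
Proof.
  intros Hz; unfold unit_disk in Hz; assert (H0 := Cmod_ge_0 z).
  apply (ex_series_ext (fun k => ((Cmod z ^ 2) ^ k)%R)).
  - intros k; rewrite Cmod_pow, <- !pow_mult; f_equal; lia.
  - apply ex_series_geom; rewrite Rabs_pos_eq by apply pow2_ge_0; nra.
Qed.

Definition h2_fun (a : nat -> C) (z : C) : C := CSeries (fun k => z ^ k * a k).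

Lemma is_taylor_h2_fun (a : nat -> C) : l2 a -> is_taylor (h2_fun a) a.
Proof.
  intros Ha; apply is_taylor_series; intros z Hz.
  apply CSeries_correct, l2_mult_summable; [now apply l2_geom | exact Ha].
Qed.

Lemma is_taylor_lin (p q : C) (f g : C -> C) (a b : nat -> C) :
  is_taylor f a -> is_taylor g b ->
  is_taylor (fun z => p * f z + q * g z) (lin p a q b).
Proof.
  rewrite !is_taylor_series; intros Hf Hg z Hz.
  apply (is_series_C_ext (fun k => p * (z ^ k * a k) + q * (z ^ k * b k))).
  - intros k; unfold lin; ring.
  - apply is_series_C_plus; apply is_series_C_scal; auto.
Qed.

Lemma is_taylor_shift (f : C -> C) (a : nat -> C) :
  is_taylor f a -> is_taylor (fun z => z * f z) (shift a).
Proof.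
  rewrite !is_taylor_series; intros Hf z Hz.
  apply is_series_C_decr; [simpl; ring|].
  apply (is_series_C_ext (fun k => z * (z ^ k * a k))).
  - intros k; simpl; ring.
  - apply is_series_C_scal; auto.
Qed.

Lemma is_taylor_ext (f g : C -> C) (a : nat -> C) :
  (forall z, unit_disk z -> f z = g z) -> is_taylor f a -> is_taylor g a.
Proof. intros H Hf z Hz; rewrite <- H by exact Hz; now apply Hf. Qed.

Lemma is_taylor_value (f g : C -> C) (a : nat -> C) (z : C) :
  is_taylor f a -> is_taylor g a -> unit_disk z -> f z = g z.
Proof.
  rewrite !is_taylor_series; intros Hf Hg Hz.
  exact (is_series_unique_C _ _ _ (Hf z Hz) (Hg z Hz)).
Qed.

Lemma real_pseries_coef_unique (a b : nat -> R) (f : R -> R) :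
  (forall x, (Rabs x < 1)%R -> is_pseries a x (f x)) ->
  (forall x, (Rabs x < 1)%R -> is_pseries b x (f x)) ->
  forall k, a k = b k.
Proof.
  assert (radius : forall c : nat -> R,
    (forall x, (Rabs x < 1)%R -> is_pseries c x (f x)) -> Rbar_lt 0 (CV_radius c)).
  { intros c Hc; destruct (Rbar_lt_le_dec 0 (CV_radius c)) as [H|H]; [exact H|].
    assert (Hh : (Rabs (1 / 2) = 1 / 2)%R) by (apply Rabs_pos_eq; lra).
    exfalso; apply (CV_disk_outside c (1 / 2)%R).
    - apply Rbar_le_lt_trans with (1 := H); rewrite Hh; simpl; lra.
    - apply ex_series_lim_0; exists (f (1 / 2)%R).
      apply is_pseries_R, Hc; lra. }
  intros Ha Hb k; apply PSeries_ext_recip; [now apply radius | now apply radius|].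
  exists (mkposreal 1 Rlt_0_1); intros x Hx.
  assert (Hx1 : (Rabs x < 1)%R).
  { revert Hx; unfold ball; simpl; unfold AbsRing_ball, abs, minus, plus, opp; simpl.
    now rewrite Ropp_0, Rplus_0_r. }
  rewrite (is_pseries_unique _ _ _ (Ha x Hx1)); symmetry.
  exact (is_pseries_unique _ _ _ (Hb x Hx1)).
Qed.

(** On the segment (-1, 1) the real and imaginary parts of [f] are sums of real power series, and
    these determine their coefficients. *)
Lemma is_taylor_unique (f : C -> C) (a b : nat -> C) :
  is_taylor f a -> is_taylor f b -> a = b.
Proof.
  assert (real_part : forall c : nat -> C, is_taylor f c ->
    (forall x, (Rabs x < 1)%R -> is_pseries (fun k => Re (c k)) x (Re (f x))) /\
    (forall x, (Rabs x < 1)%R -> is_pseries (fun k => Im (c k)) x (Im (f x)))).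
  { intros c Hc; rewrite is_taylor_series in Hc; split; intros x Hx;
      apply is_pseries_R;
      (assert (Hd : unit_disk x) by (unfold unit_disk; now rewrite Cmod_R));
      destruct (proj1 (is_series_C _ _) (Hc (RtoC x) Hd)) as [H1 H2].
    - revert H1; apply is_series_ext; intros k; rewrite <- RtoC_pow, re_scal_l; apply Rmult_comm.
    - revert H2; apply is_series_ext; intros k; rewrite <- RtoC_pow, im_scal_l; apply Rmult_comm. }
  intros Ha Hb; destruct (real_part a Ha) as [Ha1 Ha2], (real_part b Hb) as [Hb1 Hb2].
  apply functional_extensionality; intros k; apply C_eq.
  - exact (real_pseries_coef_unique _ _ _ Ha1 Hb1 k).
  - exact (real_pseries_coef_unique _ _ _ Ha2 Hb2 k).
Qed.

(** Uniqueness removes the arbitrariness of the choice made by [epsilon]. *)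
Lemma taylor_eq (f : C -> C) (a : nat -> C) : is_taylor f a -> taylor f = a.
Proof.
  intros Ha; apply (is_taylor_unique f); [|exact Ha].
  apply (epsilon_spec (inhabits (fun _ : nat => RtoC 0)) (is_taylor f)).
  now exists a.
Qed.

Lemma H2_inner_eq (f g : C -> C) (a b : nat -> C) :
  is_taylor f a -> is_taylor g b -> H2_inner f g = ip a b.
Proof.
  intros Hf Hg; unfold H2_inner.
  now rewrite (taylor_eq f a Hf), (taylor_eq g b Hg).
Qed.

Lemma disk_denominator (z0 z : C) :
  unit_disk z0 -> unit_disk z -> 1 - Cconj z0 * z <> 0.
Proof.
  unfold unit_disk; intros H0 Hz H.
  assert (E : Cmod (Cconj z0 * z) = 1%R).
  { replace (Cconj z0 * z) with (RtoC 1).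
    - now rewrite Cmod_1.
    - replace (Cconj z0 * z) with (1 - (1 - Cconj z0 * z)) by ring.
      rewrite H; ring. }
  rewrite Cmod_mult, Cmod_conj in E.
  assert (G0 := Cmod_ge_0 z0); assert (G := Cmod_ge_0 z); nra.
Qed.

(** The sum [U] of the series with the recursive coefficients satisfies [U - Cconj a * z * U = f] on
    the disk, because both sides have the same coefficients; dividing gives the claim. *)
Lemma is_taylor_resolvent (a : C) (f : C -> C) (h : nat -> C) :
  unit_disk a -> l2 h -> is_taylor f h ->
  is_taylor (fun z => f z / (1 - Cconj a * z)) (resolvent (Cconj a) h).
Proof.
  intros Ha Hh Hf; set (u := resolvent (Cconj a) h).
  assert (Hu : l2 u) by (apply l2_resolvent; [now rewrite Cmod_conj | exact Hh]).
  assert (Tu := is_taylor_h2_fun u Hu).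
  apply (is_taylor_ext (h2_fun u)); [|exact Tu].
  intros z Hz.
  assert (E : f z = 1 * h2_fun u z + - Cconj a * (z * h2_fun u z)).
  { apply (is_taylor_value f (fun z => 1 * h2_fun u z + - Cconj a * (z * h2_fun u z))
             h z Hf); [|exact Hz].
    rewrite (resolvent_eq (Cconj a) h); fold u.
    now apply is_taylor_lin; [|apply is_taylor_shift]. }
  rewrite E; field; now apply disk_denominator.
Qed.

(* Multiplication by the disk automorphism with zero a, on Taylor coefficients. *)
Definition blaschke_mul (a : C) (h : nat -> C) : nat -> C :=
  lin 1 (shift (resolvent (Cconj a) h)) (- a) (resolvent (Cconj a) h).

Lemma is_taylor_blaschke_mul (a : C) (f : C -> C) (h : nat -> C) :
  unit_disk a -> l2 h -> is_taylor f h ->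
  is_taylor (fun z => disk_automorphism a z * f z) (blaschke_mul a h).
Proof.
  intros Ha Hh Hf; assert (Hu := is_taylor_resolvent a f h Ha Hh Hf).
  apply (is_taylor_ext
    (fun z => 1 * (z * (f z / (1 - Cconj a * z))) + - a * (f z / (1 - Cconj a * z)))).
  - intros z Hz; unfold disk_automorphism; field; now apply disk_denominator.
  - now apply is_taylor_lin; [apply is_taylor_shift|].
Qed.

Lemma l2_blaschke_mul (a : C) (h : nat -> C) :
  unit_disk a -> l2 h -> l2 (blaschke_mul a h).
Proof.
  intros Ha Hh; assert (Hu : l2 (resolvent (Cconj a) h))
    by (apply l2_resolvent; [now rewrite Cmod_conj | exact Hh]).
  now apply l2_lin; [apply l2_shift|].
Qed.

(* With f = (1 - conj a S) u and g = (1 - conj a S) v, both sides expand to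
   (1 + |a|^2) <u,v> - conj a <Su,v> - a <u,Sv>. *)
Lemma ip_blaschke_mul (a : C) (f g : nat -> C) :
  unit_disk a -> l2 f -> l2 g ->
  ip (blaschke_mul a f) (blaschke_mul a g) = ip f g.
Proof.
  intros Ha Hf Hg.
  set (u := resolvent (Cconj a) f); set (v := resolvent (Cconj a) g).
  assert (Hu : l2 u) by (apply l2_resolvent; [now rewrite Cmod_conj | exact Hf]).
  assert (Hv : l2 v) by (apply l2_resolvent; [now rewrite Cmod_conj | exact Hg]).
  assert (Hu' := l2_shift u Hu); assert (Hv' := l2_shift v Hv).
  unfold blaschke_mul; fold u; fold v.
  replace (ip f g)
    with (ip (lin 1 u (- Cconj a) (shift u)) (lin 1 v (- Cconj a) (shift v)))
    by (unfold u, v; now rewrite <- !resolvent_eq).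
  rewrite !ip_lin_l, !ip_lin_r, !ip_shift by (try assumption; now apply l2_lin).
  apply C_eq; simpl; ring.
Qed.

(** * The model space in terms of Taylor coefficients *)

Lemma resolvent_lin (b p q : C) (x y : nat -> C) :
  resolvent b (lin p x q y) = lin p (resolvent b x) q (resolvent b y).
Proof.
  apply functional_extensionality; intros k; induction k as [|k IH]; simpl.
  - reflexivity.
  - rewrite IH; unfold lin; simpl; ring.
Qed.

Lemma blaschke_mul_lin (a p q : C) (x y : nat -> C) :
  blaschke_mul a (lin p x q y) = lin p (blaschke_mul a x) q (blaschke_mul a y).
Proof.
  unfold blaschke_mul; rewrite resolvent_lin.
  apply functional_extensionality; intros [|k]; unfold lin; simpl; ring.
Qed.

Lemma resolvent_shift (b : C) (h : nat -> C) :
  resolvent b (shift h) = shift (resolvent b h).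
Proof.
  apply functional_extensionality; intros k; induction k as [|k IH]; simpl.
  - reflexivity.
  - rewrite IH; destruct k as [|k]; simpl; ring.
Qed.

Lemma blaschke_mul_shift (a : C) (h : nat -> C) :
  blaschke_mul a (shift h) = shift (blaschke_mul a h).
Proof.
  unfold blaschke_mul; rewrite resolvent_shift.
  apply functional_extensionality; intros [|k]; unfold lin; simpl; ring.
Qed.

(* From z = (phi + a) / (1 + conj a phi), i.e. z = a + phi - conj a z phi. *)
Lemma shift_blaschke_mul (a : C) (h : nat -> C) :
  shift h
  = lin 1 (lin a h 1 (blaschke_mul a h)) (- Cconj a) (shift (blaschke_mul a h)).
Proof.
  unfold blaschke_mul; set (u := resolvent (Cconj a) h).
  rewrite (resolvent_eq (Cconj a) h); fold u.
  apply functional_extensionality; intros [|[|k]]; unfold lin; simpl; ring.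
Qed.

Definition szego_kernel (a : C) : nat -> C := fun k => Cconj a ^ k.

Lemma l2_szego_kernel (a : C) : unit_disk a -> l2 (szego_kernel a).
Proof. intros Ha; apply l2_geom; unfold unit_disk; now rewrite Cmod_conj. Qed.

Lemma ip_szego_kernel (a : C) (h : nat -> C) : ip h (szego_kernel a) = h2_fun h a.
Proof.
  unfold ip, h2_fun; f_equal; apply functional_extensionality; intros k.
  unfold szego_kernel; rewrite Cpow_conj, Cconj_conj; ring.
Qed.

(** By the reproducing property this is the value at [a] of a product with a factor vanishing at
    [a]. *)
Lemma ip_blaschke_mul_szego_kernel (a : C) (h : nat -> C) :
  unit_disk a -> l2 h -> ip (blaschke_mul a h) (szego_kernel a) = 0.
Proof.
  intros Ha Hh; rewrite ip_szego_kernel.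
  rewrite (is_taylor_value (h2_fun (blaschke_mul a h))
             (fun z => disk_automorphism a z * h2_fun h z) (blaschke_mul a h) a).
  - unfold disk_automorphism; field; now apply disk_denominator.
  - now apply is_taylor_h2_fun, l2_blaschke_mul.
  - apply is_taylor_blaschke_mul; try assumption; now apply is_taylor_h2_fun.
  - exact Ha.
Qed.

(** Evaluation at [a] is multiplicative; in other words, the kernel is an eigenvector of the adjoint
    of the shift. *)
Lemma ip_shift_szego_kernel (a : C) (h : nat -> C) :
  unit_disk a -> l2 h ->
  ip (shift h) (szego_kernel a) = a * ip h (szego_kernel a).
Proof.
  intros Ha Hh; rewrite !ip_szego_kernel.
  apply (is_taylor_value _ (fun z => z * h2_fun h z) (shift h) a).
  - now apply is_taylor_h2_fun, l2_shift.
  - now apply is_taylor_shift, is_taylor_h2_fun.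
  - exact Ha.
Qed.

Lemma ip_szego_kernel_self (a : C) :
  unit_disk a -> ip (szego_kernel a) (szego_kernel a) = RtoC (/ (1 - Cmod a ^ 2)).
Proof.
  intros Ha; unfold unit_disk in Ha; assert (H0 := Cmod_ge_0 a).
  assert (E : forall k, szego_kernel a k * Cconj (szego_kernel a k)
                        = RtoC ((Cmod a ^ 2) ^ k)).
  { intros k; unfold szego_kernel.
    rewrite Cpow_conj, Cconj_conj, <- Cpow_mult_l, RtoC_pow, Cmod2_conj.
    f_equal; ring. }
  apply CSeries_unique, is_series_C; split.
  - apply (is_series_ext (fun k => ((Cmod a ^ 2) ^ k)%R)).
    + intros k; now rewrite E.
    + apply is_series_geom; rewrite Rabs_pos_eq by apply pow2_ge_0; nra.
  - apply (is_series_ext (fun _ => 0%R)).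
    + intros k; now rewrite E.
    + change (is_lim_seq (sum_n (fun _ => 0%R)) 0%R).
      apply (is_lim_seq_ext (fun _ => 0%R)); [|apply is_lim_seq_const].
      intros n; rewrite sum_n_const; ring.
Qed.

Definition blaschke_pow (a : C) (n : nat) : (nat -> C) -> nat -> C :=
  Nat.iter n (blaschke_mul a).

Lemma l2_blaschke_pow (a : C) (n : nat) (h : nat -> C) :
  unit_disk a -> l2 h -> l2 (blaschke_pow a n h).
Proof. intros Ha Hh; induction n as [|n IH]; [exact Hh | now apply l2_blaschke_mul]. Qed.

Lemma ip_blaschke_pow (a : C) (n : nat) (f g : nat -> C) :
  unit_disk a -> l2 f -> l2 g ->
  ip (blaschke_pow a n f) (blaschke_pow a n g) = ip f g.
Proof.
  intros Ha Hf Hg; induction n as [|n IH]; [reflexivity|].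
  rewrite <- IH; apply ip_blaschke_mul; [exact Ha| |]; now apply l2_blaschke_pow.
Qed.

Lemma blaschke_pow_add (a : C) (m n : nat) (h : nat -> C) :
  blaschke_pow a (m + n) h = blaschke_pow a m (blaschke_pow a n h).
Proof. apply Nat.iter_add. Qed.

Lemma blaschke_pow_lin (a p q : C) (n : nat) (x y : nat -> C) :
  blaschke_pow a n (lin p x q y)
  = lin p (blaschke_pow a n x) q (blaschke_pow a n y).
Proof.
  induction n as [|n IH]; [reflexivity|].
  simpl; rewrite <- blaschke_mul_lin; f_equal; exact IH.
Qed.

Lemma blaschke_pow_shift (a : C) (n : nat) (h : nat -> C) :
  blaschke_pow a n (shift h) = shift (blaschke_pow a n h).
Proof.
  induction n as [|n IH]; [reflexivity|].
  simpl; rewrite <- blaschke_mul_shift; f_equal; exact IH.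
Qed.

Lemma is_taylor_blaschke_pow (a : C) (n : nat) (f : C -> C) (h : nat -> C) :
  unit_disk a -> l2 h -> is_taylor f h ->
  is_taylor (fun z => disk_automorphism a z ^ n * f z) (blaschke_pow a n h).
Proof.
  intros Ha Hh Hf; induction n as [|n IH].
  - apply (is_taylor_ext f); [intros z _; simpl; ring | exact Hf].
  - apply (is_taylor_ext
      (fun z => disk_automorphism a z * (disk_automorphism a z ^ n * f z))).
    + intros z _; simpl; ring.
    + apply is_taylor_blaschke_mul; try assumption; now apply l2_blaschke_pow.
Qed.

(** The factor [lambda] of [Theta] is dropped: a constant of modulus 1 does not change the subspace
    of multiples of [Theta]. *)
Definition model_seq (a : C) (n : nat) (c : nat -> C) : Prop :=
  l2 c /\ forall h, l2 h -> ip c (blaschke_pow a n h) = 0.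

Lemma model_seq_lin (a : C) (n : nat) (p q : C) (x y : nat -> C) :
  unit_disk a -> model_seq a n x -> model_seq a n y -> model_seq a n (lin p x q y).
Proof.
  intros Ha [Hx Ox] [Hy Oy]; split; [now apply l2_lin|].
  intros h Hh; rewrite ip_lin_l by (try assumption; now apply l2_blaschke_pow).
  rewrite Ox, Oy by exact Hh; ring.
Qed.

(** A scalar multiple is written as a [lin] with second coefficient 0, so that the lemmas on [lin]
    apply to it. *)
Lemma is_taylor_mult_blaschke (a lambda : C) (n : nat) (Theta h : C -> C)
  (b : nat -> C) :
  unit_disk a ->
  (forall z, unit_disk z -> Theta z = lambda * disk_automorphism a z ^ n) ->
  l2 b -> is_taylor h b ->
  is_taylor (mult_op Theta h) (lin lambda (blaschke_pow a n b) 0 (blaschke_pow a n b)).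
Proof.
  intros Ha HT Hb Hh; assert (T := is_taylor_blaschke_pow a n h b Ha Hb Hh).
  apply (is_taylor_ext (fun z => lambda * (disk_automorphism a z ^ n * h z)
                                 + 0 * (disk_automorphism a z ^ n * h z))).
  - intros z Hz; unfold mult_op; rewrite HT by exact Hz; ring.
  - now apply is_taylor_lin.
Qed.

Lemma model_space_iff (a lambda : C) (n : nat) (Theta f : C -> C) :
  unit_disk a -> unit_circle lambda ->
  (forall z, unit_disk z -> Theta z = lambda * disk_automorphism a z ^ n) ->
  model_space Theta f <-> exists c, is_taylor f c /\ model_seq a n c.
Proof.
  intros Ha Hl HT; split.
  - intros [[c [Hc Lc]] O]; exists c; split; [exact Hc|]; split; [exact Lc|].
    intros h Hh; assert (Th := is_taylor_h2_fun h Hh).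
    specialize (O (h2_fun h) (ex_intro _ h (conj Th Hh))).
    rewrite (H2_inner_eq _ _ _ _ Hc (is_taylor_mult_blaschke _ _ _ _ _ _ Ha HT Hh Th))
      in O.
    rewrite ip_lin_r in O by (try exact Lc; now apply l2_blaschke_pow).
    replace (ip c (blaschke_pow a n h))
      with (lambda * (Cconj lambda * ip c (blaschke_pow a n h)
                      + Cconj 0 * ip c (blaschke_pow a n h))).
    + rewrite O; ring.
    + replace (Cconj 0) with (RtoC 0) by (apply C_eq; simpl; ring).
      transitivity ((lambda * Cconj lambda) * ip c (blaschke_pow a n h)); [ring|].
      rewrite <- Cmod2_conj, Hl.
      replace (RtoC (1 ^ 2)) with (RtoC 1) by (f_equal; ring); ring.
  - intros [c [Hc [Lc O]]]; split; [now exists c|].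
    intros h [b [Hb Lb]].
    rewrite (H2_inner_eq _ _ _ _ Hc (is_taylor_mult_blaschke _ _ _ _ _ _ Ha HT Lb Hb)).
    rewrite ip_lin_r by (try exact Lc; now apply l2_blaschke_pow).
    rewrite O by exact Lb; ring.
Qed.

(** The decomposition of [shift c] shows that a projection exists, so [epsilon] returns one.
    Whatever it returns differs from [shift c] by a vector orthogonal to the model space, in
    particular to [c], and so has the same inner product with [c]; it need not be identified with
    [g]. *)
Lemma numerical_range_of_seq (a lambda : C) (n : nat) (Theta : C -> C)
  (c g h : nat -> C) :
  unit_disk a -> unit_circle lambda ->
  (forall z, unit_disk z -> Theta z = lambda * disk_automorphism a z ^ n) ->
  model_seq a n c -> model_seq a n g -> l2 h -> ip c c = 1 ->
  shift c = lin 1 g 1 (blaschke_pow a n h) ->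
  numerical_range (model_space Theta) (compressed_shift Theta) (ip (shift c) c).
Proof.
  intros Ha Hl HT Kc Kg Hh Nc E.
  assert (Lc := proj1 Kc); assert (Lg := proj1 Kg).
  assert (Tc := is_taylor_h2_fun c Lc); assert (Tg := is_taylor_h2_fun g Lg).
  assert (Tz := is_taylor_shift _ _ Tc).
  assert (Hf : model_space Theta (h2_fun c))
    by (apply (model_space_iff a lambda n); try assumption; now exists c).
  assert (sub : forall (G : C -> C) d, is_taylor G d ->
    is_taylor (fun z => mult_op (fun z => z) (h2_fun c) z - G z)
              (lin 1 (shift c) (-1) d)).
  { intros G d Td.
    apply (is_taylor_ext (fun z => 1 * (z * h2_fun c z) + (-1) * G z)).
    - intros z _; unfold mult_op; ring.
    - now apply is_taylor_lin. }
  exists (h2_fun c); split; [exact Hf|]; split.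
  - unfold H2_norm; rewrite (H2_inner_eq _ _ _ _ Tc Tc), Nc; apply sqrt_1.
  - destruct (epsilon_spec (inhabits (mult_op (fun z => z) (h2_fun c)))
      (fun G => model_space Theta G /\ forall k, model_space Theta k ->
         H2_inner (fun z => mult_op (fun z => z) (h2_fun c) z - G z) k = 0))
      as [KA OA].
    + exists (h2_fun g); split.
      * apply (model_space_iff a lambda n); try assumption; now exists g.
      * intros k Hk.
        destruct (proj1 (model_space_iff a lambda n Theta k Ha Hl HT) Hk)
          as [d [Td [Ld Od]]].
        rewrite (H2_inner_eq _ _ _ _ (sub _ _ Tg) Td).
        replace (lin 1 (shift c) (-1) g) with (blaschke_pow a n h).
        -- assert (Lh := l2_blaschke_pow a n h Ha Hh).
           rewrite (ip_conj d) by assumption; rewrite Od by exact Hh.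
           apply C_eq; simpl; ring.
        -- rewrite E; apply functional_extensionality; intros j; unfold lin; ring.
    + fold (orth_proj (model_space Theta) (mult_op (fun z => z) (h2_fun c))) in KA, OA.
      fold (compressed_shift Theta (h2_fun c)) in KA, OA.
      specialize (OA _ Hf).
      destruct (proj1 (model_space_iff a lambda n Theta _ Ha Hl HT) KA)
        as [d [Td [Ld _]]].
      rewrite (H2_inner_eq _ _ _ _ (sub _ _ Td) Tc) in OA.
      rewrite (H2_inner_eq _ _ _ _ Td Tc).
      rewrite ip_lin_l in OA by (try assumption; now apply l2_shift).
      replace (ip (shift c) c) with (1 * ip (shift c) c + (-1) * ip d c + ip d c) by ring.
      rewrite OA; ring.
Qed.

(** * The matrix of the compressed shift *)

(** The Takenaka-Malmquist vectors, left unnormalised: they share the squared norm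
    [/ (1 - Cmod a ^ 2)], so a single square root, in [numerical_range_shift_form], normalises them
    all. *)
Definition tm_basis (a : C) (j : nat) : nat -> C := blaschke_pow a j (szego_kernel a).

Lemma l2_tm_basis (a : C) (j : nat) : unit_disk a -> l2 (tm_basis a j).
Proof. intros Ha; now apply l2_blaschke_pow, l2_szego_kernel. Qed.

(* Matches on the head symbol: unification alone would unfold tm_basis down to lin. *)
Ltac l2_combination L :=
  repeat match goal with
    | |- l2 (lin _ _ _ _) => apply l2_lin
    | |- l2 (shift _) => apply l2_shift
    | |- l2 _ => apply L
    end.

Lemma shift_lin (p q : C) (x y : nat -> C) :
  shift (lin p x q y) = lin p (shift x) q (shift y).
Proof.
  apply functional_extensionality; intros [|k]; unfold lin; simpl; ring.
Qed.

Lemma ip_tm_basis_cancel (a : C) (i j k : nat) :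
  unit_disk a -> ip (tm_basis a (i + j)) (tm_basis a (i + k))
                 = ip (tm_basis a j) (tm_basis a k).
Proof.
  intros Ha; unfold tm_basis; rewrite !blaschke_pow_add.
  apply ip_blaschke_pow; [exact Ha| |]; now apply l2_tm_basis.
Qed.

(** Multiplication by the automorphism is isometric and commutes with the shift, so the matrix of
    the shift is Toeplitz and one entry per diagonal suffices. *)
Lemma ip_shift_tm_basis_cancel (a : C) (i j k : nat) :
  unit_disk a -> ip (shift (tm_basis a (i + j))) (tm_basis a (i + k))
                 = ip (shift (tm_basis a j)) (tm_basis a k).
Proof.
  intros Ha; unfold tm_basis; rewrite !blaschke_pow_add, <- blaschke_pow_shift.
  apply ip_blaschke_pow; [exact Ha|apply l2_shift|]; now apply l2_tm_basis.
Qed.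

Lemma ip_tm_basis_self (a : C) (j : nat) :
  unit_disk a -> ip (tm_basis a j) (tm_basis a j) = RtoC (/ (1 - Cmod a ^ 2)).
Proof.
  intros Ha; rewrite <- (Nat.add_0_r j), ip_tm_basis_cancel by exact Ha.
  now apply ip_szego_kernel_self.
Qed.

Lemma ip_tm_basis_gt (a : C) (j k : nat) :
  unit_disk a -> (k < j)%nat -> ip (tm_basis a j) (tm_basis a k) = 0.
Proof.
  intros Ha H; replace j with (k + S (j - k - 1))%nat by lia.
  rewrite <- (Nat.add_0_r k) at 3; rewrite ip_tm_basis_cancel by exact Ha.
  apply ip_blaschke_mul_szego_kernel; [exact Ha | now apply l2_tm_basis].
Qed.

Lemma ip_tm_basis_neq (a : C) (j k : nat) :
  unit_disk a -> j <> k -> ip (tm_basis a j) (tm_basis a k) = 0.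
Proof.
  intros Ha H; destruct (Nat.lt_ge_cases k j); [now apply ip_tm_basis_gt|].
  rewrite (ip_conj (tm_basis a k)) by now apply l2_tm_basis.
  rewrite ip_tm_basis_gt by (try exact Ha; lia); apply C_eq; simpl; ring.
Qed.

Lemma ip_shift_tm_basis_self (a : C) (j : nat) :
  unit_disk a ->
  ip (shift (tm_basis a j)) (tm_basis a j) = a * RtoC (/ (1 - Cmod a ^ 2)).
Proof.
  intros Ha; rewrite <- (Nat.add_0_r j), ip_shift_tm_basis_cancel by exact Ha.
  rewrite <- (ip_tm_basis_self a 0) by exact Ha.
  apply ip_shift_szego_kernel; [exact Ha | now apply l2_tm_basis].
Qed.

Lemma ip_shift_tm_basis_gt (a : C) (j k : nat) :
  unit_disk a -> (k < j)%nat -> ip (shift (tm_basis a j)) (tm_basis a k) = 0.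
Proof.
  intros Ha H; replace j with (k + S (j - k - 1))%nat by lia.
  rewrite <- (Nat.add_0_r k) at 3.
  rewrite ip_shift_tm_basis_cancel by exact Ha.
  unfold tm_basis at 1; simpl blaschke_pow.
  change (blaschke_mul a (blaschke_pow a (j - k - 1) (szego_kernel a)))
    with (blaschke_mul a (tm_basis a (j - k - 1))).
  rewrite <- blaschke_mul_shift.
  apply ip_blaschke_mul_szego_kernel; [exact Ha | now apply l2_shift, l2_tm_basis].
Qed.

Lemma gram_pos (a : C) : unit_disk a -> (0 < 1 - Cmod a ^ 2)%R.
Proof. unfold unit_disk; intros Ha; assert (H := Cmod_ge_0 a); nra. Qed.

(** Expanding [z] times the first basis vector by [shift_blaschke_mul] and cancelling one
    automorphism expresses each entry as a Gram entry minus [Cconj a] times the previous entry. The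
    Gram entry survives only at the first step, where the total is
    [(1 - |a|^2) / (1 - |a|^2) = 1]. *)
Lemma ip_shift_tm_basis_lt (a : C) (j k : nat) :
  unit_disk a -> (j < k)%nat ->
  ip (shift (tm_basis a j)) (tm_basis a k) = (- Cconj a) ^ (k - j - 1).
Proof.
  intros Ha Hjk; replace k with (j + S (k - j - 1))%nat at 1 by lia.
  rewrite <- (Nat.add_0_r j) at 1.
  rewrite ip_shift_tm_basis_cancel by exact Ha.
  generalize (k - j - 1)%nat; clear j k Hjk; intros i.
  assert (L : forall j, l2 (tm_basis a j)) by (intros; now apply l2_tm_basis).
  assert (rec : forall i, ip (shift (tm_basis a 0)) (tm_basis a (S i))
    = ip (tm_basis a 0) (tm_basis a i)
      - Cconj a * ip (shift (tm_basis a 0)) (tm_basis a i)).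
  { clear i; intros i; rewrite (shift_blaschke_mul a (tm_basis a 0)) at 1.
    change (blaschke_mul a (tm_basis a 0)) with (tm_basis a 1).
    rewrite !ip_lin_l by l2_combination L.
    rewrite (ip_tm_basis_cancel a 1 0 i Ha : ip (tm_basis a 1) (tm_basis a (S i)) = _).
    rewrite (ip_shift_tm_basis_cancel a 1 0 i Ha :
      ip (shift (tm_basis a 1)) (tm_basis a (S i)) = _).
    rewrite (ip_tm_basis_neq a 0 (S i)) by (try exact Ha; lia); ring. }
  induction i as [|i IH]; rewrite rec.
  - rewrite ip_tm_basis_self, ip_shift_tm_basis_self by exact Ha.
    assert (G := gram_pos a Ha).
    transitivity (RtoC (/ (1 - Cmod a ^ 2)) * (1 - a * Cconj a)); [simpl; ring|].
    rewrite <- Cmod2_conj, <- RtoC_minus, <- RtoC_mult; simpl Cpow; f_equal.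
    apply Rinv_l, Rgt_not_eq, G.
  - rewrite IH, (ip_tm_basis_neq a 0 (S i)) by (try exact Ha; lia); simpl; ring.
Qed.

(** After cancelling [j] common factors at least one automorphism remains on the other side, and its
    zero at [a] makes that side orthogonal to the kernel. *)
Lemma model_seq_tm_basis (a : C) (n j : nat) :
  unit_disk a -> (j < n)%nat -> model_seq a n (tm_basis a j).
Proof.
  intros Ha Hj; split; [now apply l2_tm_basis|]; intros h Hh.
  replace n with (j + S (n - j - 1))%nat by lia.
  rewrite blaschke_pow_add; unfold tm_basis.
  rewrite ip_blaschke_pow; try assumption;
    [|now apply l2_szego_kernel | now apply l2_blaschke_pow].
  rewrite (ip_conj (blaschke_pow a (S (n - j - 1)) h));
    [|now apply l2_blaschke_pow | now apply l2_szego_kernel].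
  simpl; rewrite ip_blaschke_mul_szego_kernel;
    [apply C_eq; simpl; ring | exact Ha | now apply l2_blaschke_pow].
Qed.

(** Existence of the orthogonal projection onto the model space for the single vector [d], in place
    of a projection theorem for all of H^2. *)
Definition decomposable (a : C) (n : nat) (d : nat -> C) : Prop :=
  exists g h, model_seq a n g /\ l2 h /\ d = lin 1 g 1 (blaschke_pow a n h).

Lemma decomposable_lin (a : C) (n : nat) (p q : C) (x y : nat -> C) :
  unit_disk a -> decomposable a n x -> decomposable a n y ->
  decomposable a n (lin p x q y).
Proof.
  intros Ha [g [h [Hg [Hh ->]]]] [g' [h' [Hg' [Hh' ->]]]].
  exists (lin p g q g'), (lin p h q h').
  split; [now apply model_seq_lin|]; split; [now apply l2_lin|].
  rewrite blaschke_pow_lin; apply functional_extensionality; intros k.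
  unfold lin; ring.
Qed.

Lemma decomposable_model_seq (a : C) (n : nat) (g : nat -> C) :
  model_seq a n g -> decomposable a n g.
Proof.
  intros Hg; exists g, (lin 0 g 0 g); split; [exact Hg|].
  split; [apply l2_lin; apply Hg|].
  rewrite blaschke_pow_lin; apply functional_extensionality; intros k.
  unfold lin; ring.
Qed.

Lemma decomposable_blaschke_pow (a : C) (n : nat) (h : nat -> C) :
  unit_disk a -> l2 h -> decomposable a n (blaschke_pow a n h).
Proof.
  intros Ha Hh; exists (lin 0 h 0 h), h; split; [split|].
  - now apply l2_lin.
  - intros k Hk; rewrite ip_lin_l by (try assumption; now apply l2_blaschke_pow); ring.
  - split; [exact Hh|]; apply functional_extensionality; intros k; unfold lin; ring.
Qed.

(** Descending induction from [j = n], where the shifted vector is itself a multiple of the [n]-th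
    power of the automorphism. Below, [shift_blaschke_mul] expresses the shift of vector [j] through
    vectors [j] and [j + 1] and the shift of vector [j + 1]. *)
Lemma decomposable_shift_tm_basis (a : C) (n j : nat) :
  unit_disk a -> (j <= n)%nat -> decomposable a n (shift (tm_basis a j)).
Proof.
  intros Ha Hj; replace j with (n - (n - j))%nat by lia.
  assert (Hi : (n - j <= n)%nat) by lia; revert Hi; generalize (n - j)%nat.
  assert (Kb : forall j, (j <= n)%nat -> decomposable a n (tm_basis a j)).
  { intros k Hk; destruct (Nat.eq_dec k n) as [->|].
    - now apply decomposable_blaschke_pow, l2_szego_kernel.
    - apply decomposable_model_seq, model_seq_tm_basis; [exact Ha | lia]. }
  intros i; induction i as [|i IH]; intros Hi.
  - rewrite Nat.sub_0_r; unfold tm_basis; rewrite <- blaschke_pow_shift.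
    now apply decomposable_blaschke_pow, l2_shift, l2_szego_kernel.
  - rewrite (shift_blaschke_mul a).
    change (blaschke_mul a (tm_basis a (n - S i))) with (tm_basis a (S (n - S i))).
    replace (S (n - S i)) with (n - i)%nat by lia.
    repeat apply decomposable_lin; try exact Ha; try (apply Kb; lia).
    apply IH; lia.
Qed.

(** The inner product of [N^j x] and [y], for the 4 x 4 nilpotent Jordan block [N] sending each
    basis vector to the next; the last branch is the case [j = 3]. *)
Definition cross_lag (x y : nat -> C) (j : nat) : C :=
  match j with
  | 0%nat => x 0%nat * Cconj (y 0%nat) + x 1%nat * Cconj (y 1%nat)
         + x 2%nat * Cconj (y 2%nat) + x 3%nat * Cconj (y 3%nat)
  | 1%nat => x 0%nat * Cconj (y 1%nat) + x 1%nat * Cconj (y 2%nat)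
         + x 2%nat * Cconj (y 3%nat)
  | 2%nat => x 0%nat * Cconj (y 2%nat) + x 1%nat * Cconj (y 3%nat)
  | _ => x 0%nat * Cconj (y 3%nat)
  end.

Definition lag_sum (x : nat -> C) (j : nat) : C := cross_lag x x j.

(* The matrix of the compressed shift in the normalized basis is a + q (N - conj a N^2
   + conj a^2 N^3), where q = 1 - |a|^2 and N is the nilpotent Jordan block. *)
Definition shift_form (a : C) (x : nat -> C) : C :=
  a * lag_sum x 0 + (1 - a * Cconj a) *
    (lag_sum x 1 - Cconj a * lag_sum x 2 + Cconj a ^ 2 * lag_sum x 3).

Definition tm_comb (a : C) (x : nat -> C) : nat -> C :=
  lin 1 (lin (x 0%nat) (tm_basis a 0) (x 1%nat) (tm_basis a 1))
      1 (lin (x 2%nat) (tm_basis a 2) (x 3%nat) (tm_basis a 3)).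

Lemma Cconj_R (r : R) : Cconj (RtoC r) = RtoC r.
Proof. apply C_eq; simpl; ring. Qed.

Lemma ip_tm_comb (a : C) (x : nat -> C) :
  unit_disk a ->
  ip (tm_comb a x) (tm_comb a x) = RtoC (/ (1 - Cmod a ^ 2)) * lag_sum x 0.
Proof.
  intros Ha; assert (L : forall j, l2 (tm_basis a j)) by (intros; now apply l2_tm_basis).
  unfold tm_comb; rewrite !ip_lin_l, !ip_lin_r by l2_combination L.
  rewrite !ip_tm_basis_self by exact Ha.
  rewrite !ip_tm_basis_neq by (try exact Ha; lia).
  rewrite Cconj_R; unfold lag_sum, cross_lag; ring.
Qed.

Lemma ip_shift_tm_comb (a : C) (x : nat -> C) :
  unit_disk a ->
  ip (shift (tm_comb a x)) (tm_comb a x)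
  = RtoC (/ (1 - Cmod a ^ 2)) * shift_form a x.
Proof.
  intros Ha; assert (L : forall j, l2 (tm_basis a j)) by (intros; now apply l2_tm_basis).
  unfold tm_comb; rewrite !shift_lin.
  rewrite !ip_lin_l, !ip_lin_r by l2_combination L.
  rewrite !ip_shift_tm_basis_self by exact Ha.
  rewrite (ip_shift_tm_basis_lt a 0 1), (ip_shift_tm_basis_lt a 0 2),
    (ip_shift_tm_basis_lt a 0 3), (ip_shift_tm_basis_lt a 1 2),
    (ip_shift_tm_basis_lt a 1 3), (ip_shift_tm_basis_lt a 2 3)
    by (try exact Ha; lia).
  rewrite !ip_shift_tm_basis_gt by (try exact Ha; lia).
  rewrite Cconj_R; unfold shift_form.
  assert (G := gram_pos a Ha).
  assert (E : RtoC (/ (1 - Cmod a ^ 2)) * (1 - a * Cconj a) = 1).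
  { rewrite <- Cmod2_conj, <- RtoC_minus, <- RtoC_mult; f_equal; field; lra. }
  set (w := RtoC (/ (1 - Cmod a ^ 2))) in *.
  transitivity (w * a * lag_sum x 0 + w * (1 - a * Cconj a) *
    (lag_sum x 1 - Cconj a * lag_sum x 2 + Cconj a ^ 2 * lag_sum x 3)); [|ring].
  rewrite E; unfold lag_sum, cross_lag; simpl Nat.sub; simpl Cpow; ring.
Qed.

Lemma numerical_range_shift_form (a lambda : C) (n : nat) (Theta : C -> C)
  (x : nat -> C) :
  unit_disk a -> unit_circle lambda ->
  (forall z, unit_disk z -> Theta z = lambda * disk_automorphism a z ^ n) ->
  (3 <= n)%nat -> (4 <= n)%nat \/ x 3%nat = 0 -> lag_sum x 0 = 1 ->
  numerical_range (model_space Theta) (compressed_shift Theta) (shift_form a x).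
Proof.
  intros Ha Hl HT Hn H3 Hx; assert (G := gram_pos a Ha).
  set (s := RtoC (sqrt (1 - Cmod a ^ 2))).
  assert (Ls : s * s * RtoC (/ (1 - Cmod a ^ 2)) = 1).
  { unfold s; rewrite <- !RtoC_mult, sqrt_sqrt by lra; f_equal; field; lra. }
  assert (Cs : Cconj s = s) by apply Cconj_R.
  set (c := tm_comb a (fun k => s * x k)).
  assert (Ec : ip c c = 1).
  { unfold c; rewrite ip_tm_comb by exact Ha; unfold lag_sum, cross_lag.
    rewrite !Cmult_conj; rewrite !Cs.
    unfold lag_sum, cross_lag in Hx.
    transitivity (s * s * RtoC (/ (1 - Cmod a ^ 2)) * 1);
      [rewrite <- Hx; ring | rewrite Ls; ring]. }
  assert (Es : ip (shift c) c = shift_form a x).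
  { unfold c; rewrite ip_shift_tm_comb by exact Ha; unfold shift_form, lag_sum, cross_lag.
    rewrite !Cmult_conj; rewrite !Cs.
    transitivity (s * s * RtoC (/ (1 - Cmod a ^ 2)) * shift_form a x);
      [|rewrite Ls; unfold shift_form, lag_sum, cross_lag; ring].
    unfold shift_form, lag_sum, cross_lag; ring. }
  assert (Kc : model_seq a n c).
  { apply model_seq_lin; [exact Ha| |].
    - apply model_seq_lin; try exact Ha; apply model_seq_tm_basis; try exact Ha; lia.
    - destruct H3 as [H3|H3].
      + apply model_seq_lin; try exact Ha; apply model_seq_tm_basis; try exact Ha; lia.
      (* If [n = 3], the vector [tm_basis a 3] lies outside the model space; since its coefficient
         is 0, [tm_basis a 2] can stand in for it. *)
      + rewrite H3.
        replace (lin _ _ _ _) with (lin (s * x 2%nat) (tm_basis a 2) 0 (tm_basis a 2)).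
        * apply model_seq_lin; try exact Ha; apply model_seq_tm_basis; try exact Ha; lia.
        * apply functional_extensionality; intros k; unfold lin; ring. }
  (* Index 3 is admissible even if [n = 3]: [decomposable_shift_tm_basis] allows [j = n]. *)
  assert (Dc : decomposable a n (shift c)).
  { unfold c, tm_comb; rewrite !shift_lin.
    destruct H3 as [H3|H3].
    - repeat apply decomposable_lin; try exact Ha;
        apply decomposable_shift_tm_basis; try exact Ha; lia.
    - repeat apply decomposable_lin; try exact Ha;
        apply decomposable_shift_tm_basis; try exact Ha; lia. }
  destruct Dc as [g [h [Kg [Lh E]]]].
  rewrite <- Es; now apply (numerical_range_of_seq a lambda n Theta c g h).
Qed.

(** * Segments and disks in the numerical range *)

(* Only the entries of x at 0, 1, 2, 3 are used; for m = 3 the last one is 0. *)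
Definition form_range (m : nat) (a w : C) : Prop :=
  exists x : nat -> C, ((m <= 3)%nat -> x 3%nat = 0) /\ lag_sum x 0 = 1 /\ shift_form a x = w.

Lemma lag_sum_0 (x : nat -> C) :
  lag_sum x 0 = RtoC (Cmod (x 0%nat) ^ 2 + Cmod (x 1%nat) ^ 2
                      + Cmod (x 2%nat) ^ 2 + Cmod (x 3%nat) ^ 2).
Proof. rewrite !RtoC_plus, !Cmod2_conj; reflexivity. Qed.

Lemma Re_lag_sum_0 (x : nat -> C) : lag_sum x 0 = RtoC (Re (lag_sum x 0)).
Proof. now rewrite lag_sum_0. Qed.

Lemma Re_lag_sum_0_pos (x : nat -> C) :
  (exists k, (k <= 3)%nat /\ x k <> 0) -> (0 < Re (lag_sum x 0))%R.
Proof.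
  intros [k [Hk Hx]]; rewrite lag_sum_0; simpl Re.
  assert (H : forall j, (0 <= Cmod (x j) ^ 2)%R) by (intros; apply pow2_ge_0).
  assert (0 < Cmod (x k) ^ 2)%R by (apply pow_lt; now apply Cmod_gt_0).
  assert (E : (k = 0 \/ k = 1 \/ k = 2 \/ k = 3)%nat) by lia.
  generalize (H 0%nat) (H 1%nat) (H 2%nat) (H 3%nat).
  destruct E as [->|[->|[->| ->]]]; lra.
Qed.

Lemma lag_sum_scal (s : C) (x : nat -> C) (j : nat) :
  lag_sum (fun k => s * x k) j = s * Cconj s * lag_sum x j.
Proof. destruct j as [|[|[|j]]]; unfold lag_sum, cross_lag; rewrite !Cmult_conj; ring. Qed.

Lemma shift_form_scal (a s : C) (x : nat -> C) :
  shift_form a (fun k => s * x k) = s * Cconj s * shift_form a x.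
Proof. unfold shift_form; rewrite !lag_sum_scal; ring. Qed.

Lemma form_range_of_vector (m : nat) (a w : C) (x : nat -> C) :
  ((m <= 3)%nat -> x 3%nat = 0) -> (0 < Re (lag_sum x 0))%R ->
  shift_form a x = w * lag_sum x 0 -> form_range m a w.
Proof.
  intros H3 HN E; set (N := Re (lag_sum x 0)) in *.
  assert (EN : lag_sum x 0 = RtoC N) by apply Re_lag_sum_0.
  set (s := RtoC (/ sqrt N)).
  assert (Hs : s * Cconj s * RtoC N = 1).
  { unfold s; rewrite Cconj_R, <- !RtoC_mult; f_equal.
    assert (sqrt N <> 0)%R by (apply Rgt_not_eq, sqrt_lt_R0, HN).
    rewrite <- (sqrt_sqrt N) at 3 by lra; field; assumption. }
  exists (fun k => s * x k); split; [|split].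
  - intros Hm; rewrite H3 by exact Hm; ring.
  - now rewrite lag_sum_scal, EN.
  - rewrite shift_form_scal, E, EN.
    transitivity (s * Cconj s * RtoC N * w); [ring | rewrite Hs; ring].
Qed.

(** The diagonal unitary with entries [Cconj u ^ k] multiplies the lag [j] by [u ^ j]. Together with
    the powers of [Cconj u] that come from replacing [r] by [u * r], every term gains exactly one
    factor [u]. *)
Lemma form_range_rotate (m : nat) (r : R) (u w : C) :
  unit_circle u -> form_range m r w -> form_range m (u * r) (u * w).
Proof.
  intros Hu [x [H3 [Hx Hw]]].
  assert (Huv : u * Cconj u = 1).
  { rewrite <- Cmod2_conj, Hu; f_equal; ring. }
  assert (Hlag : forall j, (j <= 3)%nat ->
    lag_sum (fun k => Cconj u ^ k * x k) j = u ^ j * lag_sum x j).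
  { intros j Hj; destruct j as [|[|[|[|j]]]]; [..|lia]; unfold lag_sum, cross_lag;
      rewrite !Cmult_conj, !Cpow_conj, !Cconj_conj;
      set (v := Cconj u) in *; simpl Cpow; ring [Huv]. }
  exists (fun k => Cconj u ^ k * x k); split; [|split].
  - intros Hm; rewrite H3 by exact Hm; ring.
  - rewrite Hlag, Hx by lia; simpl; ring.
  - unfold shift_form; rewrite !Hlag by lia.
    rewrite <- Hw; unfold shift_form.
    rewrite !Cmult_conj, !Cconj_R; set (v := Cconj u) in *; simpl Cpow; ring [Huv].
Qed.

(** The sesquilinear form of the matrix minus [w]: a nonzero vector on which it vanishes realises
    [w]. *)
Definition cross_form (a w : C) (x y : nat -> C) : C :=
  (a - w) * cross_lag x y 0 + (1 - a * Cconj a) *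
    (cross_lag x y 1 - Cconj a * cross_lag x y 2 + Cconj a ^ 2 * cross_lag x y 3).

Lemma cross_form_self (a w : C) (x : nat -> C) :
  cross_form a w x x = shift_form a x - w * lag_sum x 0.
Proof. unfold cross_form, shift_form, lag_sum, cross_lag; ring. Qed.

Lemma cross_form_lin_l (a w p q : C) (x y z : nat -> C) :
  cross_form a w (lin p x q y) z = p * cross_form a w x z + q * cross_form a w y z.
Proof. unfold cross_form, cross_lag, lin; ring. Qed.

Lemma cross_form_lin_r (a w p q : C) (x y z : nat -> C) :
  cross_form a w z (lin p x q y)
  = Cconj p * cross_form a w z x + Cconj q * cross_form a w z y.
Proof.
  unfold cross_form, cross_lag, lin; rewrite !Cplus_conj, !Cmult_conj; ring.
Qed.

Lemma cross_form_zero (a w : C) (x y : nat -> C) :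
  (forall k, (k <= 3)%nat -> x k = 0) ->
  cross_form a w x y = 0 /\ cross_form a w y x = 0.
Proof.
  intros H; unfold cross_form, cross_lag.
  rewrite !H by lia; rewrite Cconj_R; split; ring.
Qed.

(* The phase c makes conj c b1 + c b2 real, so that the intermediate value theorem applies. *)
Lemma hermitian_zero_on_segment (P Q : R) (b1 b2 : C) :
  (0 < P)%R -> (0 < Q)%R ->
  exists (t : R) (c : C), (0 < t < 1)%R /\ unit_circle c /\
    RtoC ((1 - t) ^ 2 * P - t ^ 2 * Q) + RtoC (t * (1 - t)) * (Cconj c * b1 + c * b2) = 0.
Proof.
  intros HP HQ; set (d := b1 - Cconj b2).
  assert (Hc : exists c, unit_circle c /\ Im (Cconj c * b1 + c * b2) = 0%R).
  { assert (E : forall c, Im (Cconj c * b1 + c * b2) = Im (Cconj c * d))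
      by (intros c; unfold d; simpl; ring).
    destruct (Ceq_dec d 0) as [Hd|Hd].
    - exists 1; split; [apply Cmod_1|]; rewrite E, Hd; simpl; ring.
    - assert (Hm := proj1 (Cmod_gt_0 d) Hd).
      exists (RtoC (/ Cmod d) * d); split.
      + unfold unit_circle; rewrite Cmod_mult, Cmod_R, Rabs_pos_eq.
        * apply Rinv_l; lra.
        * left; now apply Rinv_0_lt_compat.
      + rewrite E, Cmult_conj, Cconj_R.
        replace (RtoC (/ Cmod d) * Cconj d * d)
          with (RtoC (/ Cmod d) * (d * Cconj d)) by ring.
        rewrite <- Cmod2_conj; simpl; ring. }
  destruct Hc as [c [Hc Him]]; set (r := Re (Cconj c * b1 + c * b2)) in *.
  assert (Er : Cconj c * b1 + c * b2 = RtoC r) by (apply C_eq; [reflexivity | exact Him]).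
  set (f := fun t => ((1 - t) ^ 2 * P - t ^ 2 * Q + t * (1 - t) * r)%R).
  destruct (IVT_gen f 0 1 0) as [t [Ht Hf]].
  - unfold f; reg.
  - replace (f 0)%R with P by (unfold f; ring).
    replace (f 1)%R with (- Q)%R by (unfold f; ring).
    rewrite Rmin_right, Rmax_left by lra; lra.
  - rewrite Rmin_left, Rmax_right in Ht by lra.
    exists t, c; split; [|split; [exact Hc|]].
    + split; apply Rnot_le_lt; intros H.
      * replace t with 0%R in Hf by lra; unfold f in Hf; lra.
      * replace t with 1%R in Hf by lra; unfold f in Hf; lra.
    + rewrite Er, <- RtoC_mult, <- RtoC_plus; f_equal; exact Hf.
Qed.

(** The Toeplitz-Hausdorff argument on a vertical segment: [x] and [y] have values straight above
    and straight below [w], and a combination of them has the value [w]. *)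
Lemma form_range_between (m : nat) (a w : C) (x y : nat -> C) (P Q : R) :
  ((m <= 3)%nat -> x 3%nat = 0) -> ((m <= 3)%nat -> y 3%nat = 0) ->
  (0 < P)%R -> (0 < Q)%R ->
  shift_form a x = w * lag_sum x 0 + Ci * P ->
  shift_form a y = w * lag_sum y 0 - Ci * Q ->
  form_range m a w.
Proof.
  intros Hx3 Hy3 HP HQ Hx Hy.
  assert (Bx : cross_form a w x x = Ci * P) by (rewrite cross_form_self, Hx; ring).
  assert (By : cross_form a w y y = - Ci * Q) by (rewrite cross_form_self, Hy; ring).
  assert (Ci2 : Ci * Ci = -1) by (apply C_eq; simpl; ring).
  (* The factor [- Ci] divides the form by [Ci], so that its values at [x] and [y] are the reals [P]
     and [- Q]. *)
  destruct (hermitian_zero_on_segment P Q (- Ci * cross_form a w x y)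
              (- Ci * cross_form a w y x) HP HQ) as [t [c [Ht [Hc E]]]].
  assert (Hcc : c * Cconj c = 1).
  { rewrite <- Cmod2_conj, Hc; f_equal; ring. }
  set (z := lin (RtoC (1 - t)) x (RtoC t * c) y).
  assert (Ez : cross_form a w z z
    = Ci * (RtoC ((1 - t) ^ 2 * P - t ^ 2 * Q) + RtoC (t * (1 - t)) *
        (Cconj c * (- Ci * cross_form a w x y) + c * (- Ci * cross_form a w y x)))).
  { unfold z; rewrite cross_form_lin_l, !cross_form_lin_r, Bx, By.
    rewrite Cmult_conj, !Cconj_R.
    replace (RtoC ((1 - t) ^ 2 * P - t ^ 2 * Q))
      with (RtoC (1 - t) * RtoC (1 - t) * P - RtoC t * RtoC t * Q)
      by (rewrite <- !RtoC_mult, <- RtoC_minus; f_equal; ring).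
    rewrite (RtoC_mult t (1 - t)).
    set (v := Cconj c) in *; ring [Ci2 Hcc]. }
  rewrite E in Ez.
  apply (form_range_of_vector m a w z).
  - intros Hm; unfold z, lin; rewrite Hx3, Hy3 by exact Hm; ring.
  - apply Re_lag_sum_0_pos.
    destruct (Ceq_dec (z 0%nat) 0) as [H0|]; [|exists 0%nat; split; [lia|assumption]].
    destruct (Ceq_dec (z 1%nat) 0) as [H1|]; [|exists 1%nat; split; [lia|assumption]].
    destruct (Ceq_dec (z 2%nat) 0) as [H2|]; [|exists 2%nat; split; [lia|assumption]].
    destruct (Ceq_dec (z 3%nat) 0) as [H3|]; [|exists 3%nat; split; [lia|assumption]].
    assert (Z : forall k, (k <= 3)%nat -> z k = 0).
    { intros k Hk; destruct k as [|[|[|[|k]]]]; try assumption; lia. }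
    (* If [z] were zero, the form would vanish at [(x, z)] and [(z, y)]; eliminating
       [cross_form a w x y] from these two equations leaves [(1 - t) ^ 2 * P + t ^ 2 * Q = 0]. *)
    exfalso.
    destruct (cross_form_zero a w z x Z) as [_ F1].
    destruct (cross_form_zero a w z y Z) as [F2 _].
    unfold z in F1, F2; rewrite cross_form_lin_r, Bx, Cmult_conj, !Cconj_R in F1.
    rewrite cross_form_lin_l, By in F2.
    assert (F : RtoC ((1 - t) ^ 2 * P + t ^ 2 * Q) = 0).
    { replace (RtoC ((1 - t) ^ 2 * P + t ^ 2 * Q))
        with (RtoC (1 - t) * RtoC (1 - t) * P + RtoC t * RtoC t * Q)
        by (rewrite <- !RtoC_mult, <- RtoC_plus; f_equal; ring).
      set (v := Cconj c) in *; set (p := RtoC (1 - t)) in *.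
      transitivity (- Ci * (p * (p * (Ci * P) + RtoC t * v * cross_form a w x y)
        - RtoC t * v * (p * cross_form a w x y + RtoC t * c * (- Ci * Q)))).
      - ring [Ci2 Hcc].
      - rewrite F1, F2; ring. }
    apply RtoC_inj in F.
    assert (0 < (1 - t) ^ 2 * P)%R by (apply Rmult_lt_0_compat; [apply pow_lt; lra | lra]).
    assert (0 < t ^ 2 * Q)%R by (apply Rmult_lt_0_compat; [apply pow_lt; lra | lra]).
    lra.
  - rewrite cross_form_self in Ez.
    transitivity (shift_form a z - w * lag_sum z 0 + w * lag_sum z 0); [ring|].
    rewrite Ez; ring.
Qed.

Lemma lag_sum_conj (x : nat -> C) (j : nat) :
  lag_sum (fun k => Cconj (x k)) j = Cconj (lag_sum x j).
Proof.
  destruct j as [|[|[|j]]]; unfold lag_sum, cross_lag;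
    rewrite ?Cplus_conj, ?Cmult_conj, ?Cconj_conj; ring.
Qed.

Lemma shift_form_conj (a : R) (x : nat -> C) :
  shift_form a (fun k => Cconj (x k)) = Cconj (shift_form a x).
Proof.
  unfold shift_form; rewrite !lag_sum_conj.
  rewrite ?Cplus_conj, ?Cmult_conj, ?Cminus_conj, ?Cplus_conj, ?Cminus_conj, ?Cmult_conj,
    ?Cpow_conj, ?Cmult_conj, !Cconj_R; ring.
Qed.

(** * Continuous families of vectors and the disk they enclose *)

Definition C_continuity (f : R -> C) : Prop :=
  continuity (fun t => Re (f t)) /\ continuity (fun t => Im (f t)).

Lemma C_continuity_const (c : C) : C_continuity (fun _ => c).
Proof. split; apply continuity_const; intros ? ?; reflexivity. Qed.

Lemma C_continuity_plus (f g : R -> C) :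
  C_continuity f -> C_continuity g -> C_continuity (fun t => f t + g t).
Proof.
  intros [F1 F2] [G1 G2]; split.
  - exact (continuity_plus _ _ F1 G1).
  - exact (continuity_plus _ _ F2 G2).
Qed.

Lemma C_continuity_mult (f g : R -> C) :
  C_continuity f -> C_continuity g -> C_continuity (fun t => f t * g t).
Proof.
  intros [F1 F2] [G1 G2]; split.
  - exact (continuity_minus _ _ (continuity_mult _ _ F1 G1) (continuity_mult _ _ F2 G2)).
  - exact (continuity_plus _ _ (continuity_mult _ _ F1 G2) (continuity_mult _ _ F2 G1)).
Qed.

Lemma C_continuity_conj (f : R -> C) :
  C_continuity f -> C_continuity (fun t => Cconj (f t)).
Proof. intros [F1 F2]; split; [exact F1 | exact (continuity_opp _ F2)]. Qed.

Lemma C_continuity_lag_sum (v : R -> nat -> C) (j : nat) :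
  (forall k, C_continuity (fun t => v t k)) -> C_continuity (fun t => lag_sum (v t) j).
Proof.
  intros H; destruct j as [|[|[|j]]]; unfold lag_sum; simpl;
    repeat apply C_continuity_plus; apply C_continuity_mult;
    try apply C_continuity_conj; apply H.
Qed.

Lemma C_continuity_shift_form (a : C) (v : R -> nat -> C) :
  (forall k, C_continuity (fun t => v t k)) -> C_continuity (fun t => shift_form a (v t)).
Proof.
  intros H; unfold shift_form.
  assert (L : forall c j, C_continuity (fun t => c * lag_sum (v t) j))
    by (intros; apply C_continuity_mult;
        [apply C_continuity_const | now apply C_continuity_lag_sum]).
  apply C_continuity_plus; [apply L|].
  apply C_continuity_mult; [apply C_continuity_const|].
  apply C_continuity_plus; [|apply L].
  apply C_continuity_plus; [now apply C_continuity_lag_sum|].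
  destruct (L (- Cconj a) 2%nat) as [L1 L2].
  split; [refine (eq_ind _ continuity L1 _ _) | refine (eq_ind _ continuity L2 _ _)];
    apply functional_extensionality; intros t; simpl; ring.
Qed.

(* A vector of the family whose value has real part X is found by the intermediate
   value theorem; by the support inequality this value lies above X + iY, and its
   complex conjugate is attained at the conjugate vector. *)
Lemma form_range_disk (m : nat) (a al be : R) (v : R -> nat -> C) :
  (forall t, (m <= 3)%nat -> v t 3%nat = 0) ->
  (forall k, C_continuity (fun t => v t k)) ->
  (forall t, (0 < Re (lag_sum (v t) 0))%R) ->
  (forall t, ((((al + be) / 2) * cos t + (be - al) / 2) * Re (lag_sum (v t) 0)
     <= cos t * Re (shift_form a (v t)) + sin t * Im (shift_form a (v t)))%R) ->
  (al < be)%R ->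
  forall X Y : R, ((X - al) * (X - be) + Y ^ 2 < 0)%R -> form_range m a (X, Y).
Proof.
  intros H3 Hc HN Hs Hab X Y HXY.
  assert (HY2 := pow2_ge_0 Y).
  assert (HX : (al < X < be)%R) by (split; apply Rnot_le_lt; intros H; nra).
  set (N := fun t => Re (lag_sum (v t) 0)) in *.
  set (g := fun t => (Re (shift_form a (v t)) - X * N t)%R).
  (* At [t = 0] the support inequality puts the real part of the value at or beyond [be], at
     [t = PI] at or below [al]; in between it passes through [X]. *)
  assert (g0 : (0 < g 0)%R).
  { assert (C0 := Hs 0%R); rewrite cos_0, sin_0 in C0.
    assert (0 < (be - X) * N 0)%R by (apply Rmult_lt_0_compat; [lra | apply HN]).
    unfold g, N in *; lra. }
  assert (gp : (g PI < 0)%R).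
  { assert (Cp := Hs PI); rewrite cos_PI, sin_PI in Cp.
    assert (0 < (X - al) * N PI)%R by (apply Rmult_lt_0_compat; [lra | apply HN]).
    unfold g, N in *; lra. }
  destruct (IVT_gen g 0 PI 0) as [t [Ht Hg]].
  - apply (continuity_minus (fun t => Re (shift_form a (v t))) (fun t => (X * N t)%R)).
    + apply (C_continuity_shift_form a v Hc).
    + apply (continuity_scal N); apply (C_continuity_lag_sum v 0 Hc).
  - rewrite Rmin_right, Rmax_left by lra; lra.
  - assert (HPI := PI_RGT_0); rewrite Rmin_left, Rmax_right in Ht by lra.
    assert (Hsin := sin_ge_0 t (proj1 Ht) (proj2 Ht)).
    specialize (HN t); specialize (Hs t); unfold g in Hg.
    fold (N t) in HN, Hs.
    assert (ER : Re (shift_form a (v t)) = (X * N t)%R) by lra.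
    set (Z := (Im (shift_form a (v t)) / N t)%R).
    assert (EI : Im (shift_form a (v t)) = (Z * N t)%R) by (unfold Z; field; lra).
    rewrite ER, EI in Hs.
    assert (Hs' : ((al + be) / 2 * cos t + (be - al) / 2 <= cos t * X + sin t * Z)%R).
    { apply (Rmult_le_reg_r (N t)); [exact HN | lra]. }
    assert (Hcs := sin2_cos2 t); unfold Rsqr in Hcs.
    (* By Cauchy-Schwarz, [(X, Y)] and [(X, - Y)], being inside the open disk, satisfy its support
       inequality in direction [t] strictly. *)
    assert (CS : forall e, (e = 1 \/ e = -1)%R ->
      (cos t * X + sin t * (e * Y) < (al + be) / 2 * cos t + (be - al) / 2)%R).
    { intros e He.
      assert (He2 : (e * e = 1)%R) by (destruct He; subst; ring).
      set (p := (X - (al + be) / 2)%R); set (R0 := ((be - al) / 2)%R).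
      assert (HR : (p ^ 2 + Y ^ 2 < R0 ^ 2)%R) by (unfold p, R0; nra).
      assert (HR0 : (0 < R0)%R) by (unfold R0; lra).
      assert (H : ((cos t * p + sin t * (e * Y)) ^ 2 <= p ^ 2 + Y ^ 2)%R).
      { assert (0 <= (cos t * (e * Y) - sin t * p) ^ 2)%R by apply pow2_ge_0.
        replace (p ^ 2 + Y ^ 2)%R with
          ((sin t * sin t + cos t * cos t) * (p ^ 2 + (e * e) * Y ^ 2))%R
          by (rewrite Hcs, He2; ring).
        nra. }
      assert (cos t * p + sin t * (e * Y) < R0)%R by nra.
      unfold p, R0 in *; lra. }
    assert (C1 := CS 1%R (or_introl eq_refl)); assert (C2 := CS (-1)%R (or_intror eq_refl)).
    assert (HZ1 : (Y < Z)%R) by nra.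
    assert (HZ2 : (- Y < Z)%R) by nra.
    assert (EF : shift_form a (v t) = (X, Z) * RtoC (N t)).
    { apply C_eq; [rewrite ER | rewrite EI]; simpl; ring. }
    assert (EN : lag_sum (v t) 0 = RtoC (N t)) by apply Re_lag_sum_0.
    apply (form_range_between m a (X, Y) (v t) (fun k => Cconj (v t k))
             ((Z - Y) * N t) ((Z + Y) * N t)).
    + intros Hm; now apply H3.
    + intros Hm; rewrite H3 by exact Hm; apply Cconj_R.
    + apply Rmult_lt_0_compat; lra.
    + apply Rmult_lt_0_compat; lra.
    + rewrite EF, EN; apply C_eq; simpl; ring.
    + rewrite shift_form_conj, lag_sum_conj, EF, EN; apply C_eq; simpl; ring.
Qed.

(** * Trial vectors *)

(* For e = exp (- i t), the eigenvectors of the real part of e A for its largest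
   eigenvalue a cos t + (1 - a^2) l / 2, kept as trial vectors for arbitrary l. *)
Definition trial3 (a l : R) (e : C) (k : nat) : C :=
  match k with
  | 0%nat => l - a * e
  | 1%nat => e * (l * l - a * a)
  | 2%nat => e * e * (l - a * Cconj e)
  | _ => 0
  end.

Definition trial4 (a l : R) (e : C) (k : nat) : C :=
  match k with
  | 0%nat => 1 - l * a * e
  | 1%nat => e * (l - a * e)
  | 2%nat => e * e * (l - a * Cconj e)
  | 3%nat => e * e * e * (1 - l * a * Cconj e)
  | _ => 0
  end.

Lemma trial3_norm (a l c s : R) :
  (s * s = 1 - c * c)%R ->
  Re (lag_sum (trial3 a l (c, - s)%R) 0)
  = ((l ^ 2 - a ^ 2) ^ 2 + 2 * (l ^ 2 - 2 * a * l * c + a ^ 2))%R.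
Proof. intros Hs; simpl; ring [Hs]. Qed.

Lemma trial4_norm (a l c s : R) :
  (s * s = 1 - c * c)%R ->
  Re (lag_sum (trial4 a l (c, - s)%R) 0)
  = (2 * (l ^ 2 - 2 * a * l * c + a ^ 2)
     + 2 * (1 - 2 * a * l * c + l ^ 2 * a ^ 2))%R.
Proof. intros Hs; simpl; ring [Hs]. Qed.

(** The trial vector misses the would-be eigenvalue by a multiple of the polynomial that [l] should
    annihilate. For [l > a] the multiplier is positive, so a nonpositive polynomial makes the vector
    do at least as well as an eigenvector. *)
Lemma trial3_support (a l c s : R) :
  (s * s = 1 - c * c)%R ->
  let x := trial3 a l (c, - s)%R in
  (c * Re (shift_form a x) + s * Im (shift_form a x)
   = (a * c + (1 - a ^ 2) / 2 * l) * Re (lag_sum x 0)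
     - (1 - a ^ 2) / 2 * (l ^ 2 - a ^ 2) * (l ^ 3 - (2 + a ^ 2) * l + 2 * a * c))%R.
Proof.
  intros Hs x; unfold x; rewrite trial3_norm by exact Hs; simpl; field [Hs].
Qed.

Lemma trial4_support (a l c s : R) :
  (s * s = 1 - c * c)%R ->
  let x := trial4 a l (c, - s)%R in
  (c * Re (shift_form a x) + s * Im (shift_form a x)
   = (a * c + (1 - a ^ 2) / 2 * l) * Re (lag_sum x 0)
     - (1 - a ^ 2) * ((1 + a ^ 2) * l - 2 * a * c)
       * (l ^ 2 - (1 + a ^ 2) * l + 2 * a * c - 1))%R.
Proof.
  intros Hs x; unfold x; rewrite trial4_norm by exact Hs; simpl; field [Hs].
Qed.

Lemma C_continuity_R (f : R -> R) : continuity f -> C_continuity (fun t => RtoC (f t)).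
Proof.
  intros H; split; [exact H|]; apply continuity_const; intros ? ?; reflexivity.
Qed.

Lemma C_continuity_minus (f g : R -> C) :
  C_continuity f -> C_continuity g -> C_continuity (fun t => f t - g t).
Proof.
  intros [F1 F2] [G1 G2]; split.
  - exact (continuity_minus _ _ F1 G1).
  - exact (continuity_minus _ _ F2 G2).
Qed.

Ltac C_cont := repeat first
  [ assumption | apply C_continuity_const | apply C_continuity_minus
  | apply C_continuity_mult | apply C_continuity_conj ].

Lemma C_continuity_trial (a U V : R) (k : nat) :
  C_continuity (fun t => trial3 a (U - V * cos t)%R (cos t, - sin t)%R k) /\
  C_continuity (fun t => trial4 a (U - V * cos t)%R (cos t, - sin t)%R k).
Proof.
  assert (He : C_continuity (fun t => (cos t, - sin t)%R : C)).
  { split; [exact continuity_cos | exact (continuity_opp _ continuity_sin)]. }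
  assert (Hl : C_continuity (fun t => RtoC (U - V * cos t)%R)).
  { apply C_continuity_R, continuity_minus.
    - apply continuity_const; intros ? ?; reflexivity.
    - apply (continuity_scal cos), continuity_cos. }
  destruct k as [|[|[|[|k]]]]; unfold trial3, trial4; split; C_cont.
Qed.

(** At [x = 1] and [x = -1] the cubic splits off the factors [l - a] and [l + a]; the hypotheses on
    [l1] and [l2] concern the remaining quadratics. *)
Lemma form_range_trial3 (a l1 l2 X Y : R) :
  (0 <= a < 1)%R -> (a < l1)%R -> (a < l2)%R ->
  (l1 ^ 2 + a * l1 - 2 <= 0)%R -> (l2 ^ 2 - a * l2 - 2 <= 0)%R ->
  ((X - (a - (1 - a ^ 2) / 2 * l2)) * (X - (a + (1 - a ^ 2) / 2 * l1)) + Y ^ 2 < 0)%R ->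
  form_range 3 a (X, Y).
Proof.
  intros Ha Hl1 Hl2 H1 H2.
  (* [U - V * cos t] is affine in [cos t], with value [l1] at 1 and [l2] at -1. *)
  set (U := ((l1 + l2) / 2)%R); set (V := ((l2 - l1) / 2)%R).
  assert (Hq : (0 < 1 - a ^ 2)%R) by nra.
  assert (Hl : forall t, (a < U - V * cos t)%R).
  { intros t; destruct (COS_bound t).
    assert (0 <= (1 - cos t) * (l2 - a))%R by (apply Rmult_le_pos; lra).
    assert (0 <= (1 + cos t) * (l1 - a))%R by (apply Rmult_le_pos; lra).
    destruct (Rle_lt_dec (cos t) 0).
    - assert (0 < (1 - cos t) * (l2 - a))%R by (apply Rmult_lt_0_compat; lra).
      unfold U, V; lra.
    - assert (0 < (1 + cos t) * (l1 - a))%R by (apply Rmult_lt_0_compat; lra).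
      unfold U, V; lra. }
  assert (Hp : forall t, let l := (U - V * cos t)%R in
    (l ^ 3 - (2 + a ^ 2) * l + 2 * a * cos t <= 0)%R).
  { intros t l; destruct (COS_bound t) as [Hc1 Hc2].
    set (w := ((1 + cos t) / 2)%R).
    assert (Hw : (0 <= w <= 1)%R) by (unfold w; lra).
    assert (El : l = (w * l1 + (1 - w) * l2)%R) by (unfold l, U, V, w; field).
    (* The linear terms interpolate exactly; the last summand is the gap between the cube and its
       chord, nonnegative because [l1] and [l2] are positive. *)
    assert (E : (l ^ 3 - (2 + a ^ 2) * l + 2 * a * cos t
      = w * ((l1 - a) * (l1 ^ 2 + a * l1 - 2))
        + (1 - w) * ((l2 + a) * (l2 ^ 2 - a * l2 - 2))
        - w * (1 - w) * ((l1 - l2) ^ 2 * ((1 + w) * l1 + (2 - w) * l2)))%R).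
    { rewrite El; unfold w; field. }
    assert (0 <= w * ((l1 - a) * - (l1 ^ 2 + a * l1 - 2)))%R
      by (apply Rmult_le_pos; [|apply Rmult_le_pos]; lra).
    assert (0 <= (1 - w) * ((l2 + a) * - (l2 ^ 2 - a * l2 - 2)))%R
      by (apply Rmult_le_pos; [|apply Rmult_le_pos]; lra).
    assert (0 <= w * (1 - w) * ((l1 - l2) ^ 2 * ((1 + w) * l1 + (2 - w) * l2)))%R.
    { apply Rmult_le_pos; [apply Rmult_le_pos; lra|].
      apply Rmult_le_pos; [apply pow2_ge_0|].
      apply Rplus_le_le_0_compat; apply Rmult_le_pos; lra. }
    lra. }
  assert (Hcs : forall t, (sin t * sin t = 1 - cos t * cos t)%R).
  { intros t; assert (H := sin2_cos2 t); unfold Rsqr in H; lra. }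
  apply (form_range_disk 3 a _ _ (fun t => trial3 a (U - V * cos t)%R (cos t, - sin t)%R)).
  - reflexivity.
  - intros k; apply C_continuity_trial.
  - intros t; rewrite trial3_norm by apply Hcs.
    specialize (Hl t); destruct (COS_bound t); set (l := (U - V * cos t)%R) in *.
    assert (0 < (l ^ 2 - a ^ 2) ^ 2)%R by (apply pow_lt; nra).
    assert (0 <= (l - a) ^ 2)%R by apply pow2_ge_0.
    assert (0 <= (l * a) * (1 - cos t))%R by (apply Rmult_le_pos; [apply Rmult_le_pos|]; lra).
    nra.
  - intros t; rewrite trial3_support by apply Hcs.
    specialize (Hl t); specialize (Hp t); cbv zeta in Hp.
    set (N := Re (lag_sum _ 0)).
    set (l := (U - V * cos t)%R) in *.
    assert (0 <= (1 - a ^ 2) / 2 * (l ^ 2 - a ^ 2)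
      * - (l ^ 3 - (2 + a ^ 2) * l + 2 * a * cos t))%R.
    { apply Rmult_le_pos; [apply Rmult_le_pos; nra | lra]. }
    replace ((a - (1 - a ^ 2) / 2 * l2 + (a + (1 - a ^ 2) / 2 * l1)) / 2 * cos t
      + (a + (1 - a ^ 2) / 2 * l1 - (a - (1 - a ^ 2) / 2 * l2)) / 2)%R
      with (a * cos t + (1 - a ^ 2) / 2 * l)%R by (unfold l, U, V; field).
    lra.
  - nra.
Qed.

Lemma form_range_trial4 (a l1 l2 X Y : R) :
  (0 <= a < 1)%R -> (1 <= l1)%R -> (1 <= l2)%R ->
  (l1 ^ 2 - (1 + a ^ 2) * l1 + 2 * a - 1 <= 0)%R ->
  (l2 ^ 2 - (1 + a ^ 2) * l2 - 2 * a - 1 <= 0)%R ->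
  ((X - (a - (1 - a ^ 2) / 2 * l2)) * (X - (a + (1 - a ^ 2) / 2 * l1)) + Y ^ 2 < 0)%R ->
  form_range 4 a (X, Y).
Proof.
  intros Ha Hl1 Hl2 H1 H2.
  set (U := ((l1 + l2) / 2)%R); set (V := ((l2 - l1) / 2)%R).
  assert (Hq : (0 < 1 - a ^ 2)%R) by nra.
  assert (Hl : forall t, (1 <= U - V * cos t)%R).
  { intros t; destruct (COS_bound t).
    assert (0 <= (1 - cos t) * (l2 - 1))%R by (apply Rmult_le_pos; lra).
    assert (0 <= (1 + cos t) * (l1 - 1))%R by (apply Rmult_le_pos; lra).
    unfold U, V; lra. }
  assert (Hp : forall t, let l := (U - V * cos t)%R in
    (l ^ 2 - (1 + a ^ 2) * l + 2 * a * cos t - 1 <= 0)%R).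
  { intros t l; destruct (COS_bound t) as [Hc1 Hc2].
    set (w := ((1 + cos t) / 2)%R).
    assert (Hw : (0 <= w <= 1)%R) by (unfold w; lra).
    assert (El : l = (w * l1 + (1 - w) * l2)%R) by (unfold l, U, V, w; field).
    assert (E : (l ^ 2 - (1 + a ^ 2) * l + 2 * a * cos t - 1
      = w * (l1 ^ 2 - (1 + a ^ 2) * l1 + 2 * a - 1)
        + (1 - w) * (l2 ^ 2 - (1 + a ^ 2) * l2 - 2 * a - 1)
        - w * (1 - w) * (l1 - l2) ^ 2)%R).
    { rewrite El; unfold w; field. }
    assert (0 <= w * (1 - w) * (l1 - l2) ^ 2)%R.
    { apply Rmult_le_pos; [apply Rmult_le_pos; lra | apply pow2_ge_0]. }
    nra. }
  assert (Hcs : forall t, (sin t * sin t = 1 - cos t * cos t)%R).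
  { intros t; assert (H := sin2_cos2 t); unfold Rsqr in H; lra. }
  apply (form_range_disk 4 a _ _ (fun t => trial4 a (U - V * cos t)%R (cos t, - sin t)%R)).
  - intros t Hm; lia.
  - intros k; apply C_continuity_trial.
  - intros t; rewrite trial4_norm by apply Hcs.
    specialize (Hl t); destruct (COS_bound t); set (l := (U - V * cos t)%R) in *.
    assert (0 < (l - a) ^ 2)%R by (apply pow_lt; lra).
    assert (0 <= (1 - l * a) ^ 2)%R by apply pow2_ge_0.
    assert (0 <= (l * a) * (1 - cos t))%R by (apply Rmult_le_pos; [apply Rmult_le_pos|]; lra).
    nra.
  - intros t; rewrite trial4_support by apply Hcs.
    specialize (Hl t); specialize (Hp t); cbv zeta in Hp.
    set (N := Re (lag_sum _ 0)).
    set (l := (U - V * cos t)%R) in *.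
    (* From [1 <= l] follows [(1 + a^2) * l >= 2 * a >= 2 * a * cos t]. *)
    assert (0 <= (1 - a ^ 2) * ((1 + a ^ 2) * l - 2 * a * cos t)
      * - (l ^ 2 - (1 + a ^ 2) * l + 2 * a * cos t - 1))%R.
    { destruct (COS_bound t).
      apply Rmult_le_pos; [apply Rmult_le_pos; [lra|] | lra].
      assert (0 <= (1 - a) ^ 2)%R by apply pow2_ge_0.
      nra. }
    replace ((a - (1 - a ^ 2) / 2 * l2 + (a + (1 - a ^ 2) / 2 * l1)) / 2 * cos t
      + (a + (1 - a ^ 2) / 2 * l1 - (a - (1 - a ^ 2) / 2 * l2)) / 2)%R
      with (a * cos t + (1 - a ^ 2) / 2 * l)%R by (unfold l, U, V; field).
    lra.
  - nra.
Qed.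

(** * The pseudohyperbolic disk *)

(* With a = tanh s, the disk is centred at tanh (3 s / 2); in terms of b = tanh (s / 2)
   both become rational, and b -> - b exchanges the two ends of its real diameter. *)
Definition zero_of (b : R) : R := (2 * b / (1 + b ^ 2))%R.
Definition centre_of (b : R) : R := (b * (3 + b ^ 2) / (1 + 3 * b ^ 2))%R.
(** The solution [l] of [(c + r) / (1 + r * c) = a + (1 - a^2) / 2 * l], so that the end of the disk
    is compared directly with the largest root. *)
Definition end_slope (r b : R) : R :=
  (2 * (b + r) * (1 + b ^ 2) / (1 + 3 * b ^ 2 + r * b * (3 + b ^ 2)))%R.

(** The expression is affine in [r], with the positive values [1 + 3 * b^2] at [r = 0] and
    [(1 + b)^3] at [r = 1]. *)
Lemma end_slope_denominator (r b : R) :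
  (-1 < b < 1)%R -> (0 < r < 1)%R -> (0 < 1 + 3 * b ^ 2 + r * b * (3 + b ^ 2))%R.
Proof.
  intros Hb Hr.
  assert (0 < (1 + b) ^ 3)%R by (apply pow_lt; lra).
  assert (0 < 1 + 3 * b ^ 2)%R by nra.
  assert (0 < 1 + 3 * b ^ 2 + b * (3 + b ^ 2))%R.
  { replace (1 + 3 * b ^ 2 + b * (3 + b ^ 2))%R with ((1 + b) ^ 3)%R by ring; assumption. }
  nra.
Qed.

Lemma zero_of_opp (b : R) : zero_of (- b) = (- zero_of b)%R.
Proof. unfold zero_of; field; nra. Qed.

Lemma centre_of_opp (b : R) : centre_of (- b) = (- centre_of b)%R.
Proof. unfold centre_of; field; nra. Qed.

Lemma zero_of_bound (b : R) : (-1 < b < 1)%R -> (-1 < zero_of b < 1)%R.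
Proof.
  intros Hb; unfold zero_of; assert (0 < 1 + b ^ 2)%R by nra.
  split; apply (Rmult_lt_reg_r (1 + b ^ 2)); try assumption;
    replace (2 * b / (1 + b ^ 2) * (1 + b ^ 2))%R with (2 * b)%R by (field; lra); nra.
Qed.

Lemma centre_of_bound (b : R) : (-1 < b < 1)%R -> (-1 < centre_of b < 1)%R.
Proof.
  intros Hb; unfold centre_of; assert (0 < 1 + 3 * b ^ 2)%R by nra.
  assert (0 < (1 + b) ^ 3)%R by (apply pow_lt; lra).
  assert (0 < (1 - b) ^ 3)%R by (apply pow_lt; lra).
  split; apply (Rmult_lt_reg_r (1 + 3 * b ^ 2)); try assumption;
    replace (b * (3 + b ^ 2) / (1 + 3 * b ^ 2) * (1 + 3 * b ^ 2))%R
      with (b * (3 + b ^ 2))%R by (field; lra); nra.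
Qed.

Lemma zero_of_surj (a : R) : (0 <= a < 1)%R -> exists b, (-1 < b < 1)%R /\ zero_of b = a.
Proof.
  intros Ha; set (S := sqrt (1 - a ^ 2)).
  assert (HS : (S * S = 1 - a ^ 2)%R) by (apply sqrt_sqrt; nra).
  assert (HS0 : (0 <= S)%R) by apply sqrt_pos.
  (* The half-argument formula for tanh. *)
  exists (a / (1 + S))%R; split.
  - assert (E : (a / (1 + S) * (1 + S) = a)%R) by (field; lra).
    split; apply (Rmult_lt_reg_r (1 + S)); lra.
  - unfold zero_of.
    replace (1 + (a / (1 + S)) ^ 2)%R with (2 / (1 + S))%R.
    + field; lra.
    + replace ((a / (1 + S)) ^ 2)%R with ((1 - S * S) / (1 + S) ^ 2)%R
        by (rewrite HS; field; lra).
      field; lra.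
Qed.

Lemma upper_end (r b : R) :
  (-1 < b < 1)%R -> (0 < r < 1)%R ->
  ((centre_of b + r) / (1 + r * centre_of b)
   = zero_of b + (1 - zero_of b ^ 2) / 2 * end_slope r b)%R.
Proof.
  intros Hb Hr; assert (HD := end_slope_denominator r b Hb Hr).
  assert (0 < 1 + 3 * b ^ 2)%R by nra.
  unfold end_slope, centre_of, zero_of; field; repeat split; nra.
Qed.

Lemma lower_end (r b : R) :
  (-1 < b < 1)%R -> (0 < r < 1)%R ->
  ((centre_of b - r) / (1 - r * centre_of b)
   = zero_of b - (1 - zero_of b ^ 2) / 2 * end_slope r (- b))%R.
Proof.
  intros Hb Hr; assert (Hb' : (-1 < - b < 1)%R) by lra.
  assert (H := upper_end r (- b) Hb' Hr); rewrite centre_of_opp, zero_of_opp in H.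
  assert (Hc := centre_of_bound b Hb).
  assert (Hd : (1 - r * centre_of b <> 0)%R) by nra.
  transitivity (- ((- centre_of b + r) / (1 + r * - centre_of b)))%R.
  - field; lra.
  - rewrite H; field.
Qed.

(** The larger roots at [x = 1], for m = 3 of the quadratic left after splitting off [l - a]; the
    argument [- a] gives those at [x = -1]. *)
Definition top_root3 (a : R) : R := ((sqrt (a ^ 2 + 8) - a) / 2)%R.
Definition top_root4 (a : R) : R :=
  ((1 + a ^ 2 + sqrt ((1 + a ^ 2) ^ 2 + 4 - 8 * a)) / 2)%R.

Lemma top_root3_eq (a : R) : (top_root3 a ^ 2 + a * top_root3 a - 2 = 0)%R.
Proof.
  unfold top_root3; assert (H := sqrt_sqrt (a ^ 2 + 8) ltac:(nra)).
  set (S := sqrt (a ^ 2 + 8)) in *.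
  replace (((S - a) / 2) ^ 2 + a * ((S - a) / 2) - 2)%R
    with ((S * S - (a ^ 2 + 8)) / 4)%R by field.
  rewrite H; field.
Qed.

Lemma top_root3_gt (a : R) :
  (-1 < a < 1)%R -> (a < top_root3 a)%R /\ (- a < top_root3 a)%R.
Proof.
  intros Ha; unfold top_root3; assert (H := sqrt_sqrt (a ^ 2 + 8) ltac:(nra)).
  assert (H0 := sqrt_pos (a ^ 2 + 8)); set (S := sqrt (a ^ 2 + 8)) in *.
  assert (Ha2 : (a * a < 1)%R) by nra.
  split.
  - assert (3 * a < S)%R; [|lra]; apply Rnot_le_lt; intros HS.
    assert (S * S <= (3 * a) * (3 * a))%R by (apply Rmult_le_compat; lra); lra.
  - assert (- a < S)%R; [|lra]; apply Rnot_le_lt; intros HS.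
    assert (S * S <= (- a) * (- a))%R by (apply Rmult_le_compat; lra); lra.
Qed.

Lemma top_root4_eq (a : R) :
  (-1 < a < 1)%R ->
  (top_root4 a ^ 2 - (1 + a ^ 2) * top_root4 a + 2 * a - 1 = 0)%R /\ (1 <= top_root4 a)%R.
Proof.
  intros Ha; unfold top_root4.
  assert (Hd : (0 <= (1 + a ^ 2) ^ 2 + 4 - 8 * a)%R).
  { replace ((1 + a ^ 2) ^ 2 + 4 - 8 * a)%R
      with ((1 - a ^ 2) ^ 2 + 4 * (1 - a) ^ 2)%R by ring.
    assert (H1 := pow2_ge_0 (1 - a ^ 2)); assert (H2 := pow2_ge_0 (1 - a)); lra. }
  assert (H := sqrt_sqrt _ Hd); assert (H0 := sqrt_pos ((1 + a ^ 2) ^ 2 + 4 - 8 * a)).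
  set (S := sqrt ((1 + a ^ 2) ^ 2 + 4 - 8 * a)) in *; split.
  - replace (((1 + a ^ 2 + S) / 2) ^ 2 - (1 + a ^ 2) * ((1 + a ^ 2 + S) / 2) + 2 * a - 1)%R
      with ((S * S - ((1 + a ^ 2) ^ 2 + 4 - 8 * a)) / 4)%R by field.
    rewrite H; field.
  - assert (1 - a ^ 2 <= S)%R; [|lra].
    apply Rnot_lt_le; intros HS.
    assert (S * S < (1 - a ^ 2) * (1 - a ^ 2))%R by (apply Rmult_le_0_lt_compat; lra).
    assert (H2 := pow2_ge_0 (1 - a)); nra.
Qed.

(** Beyond its larger root the quadratic is positive, while at [end_slope r b] it equals
    [- 3 b^2 (1 - b^4)] over a square. Its vanishing at [b = 0] is the sharpness of the radius
    there. *)
Lemma end_slope_le_top_root3 (r b : R) :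
  (-1 < b < 1)%R -> (0 < r < 1)%R -> (r * r = 1 / 2)%R ->
  (end_slope r b <= top_root3 (zero_of b))%R.
Proof.
  intros Hb Hr Hr2; assert (HD := end_slope_denominator r b Hb Hr).
  set (l := end_slope r b); set (a := zero_of b).
  destruct (top_root3_gt a (zero_of_bound b Hb)) as [HL1 HL2].
  assert (HE := top_root3_eq a).
  set (L := top_root3 a) in *.
  apply Rnot_lt_le; intros Hl.
  assert (Hpos : (0 < l ^ 2 + a * l - 2)%R).
  { replace (l ^ 2 + a * l - 2)%R
      with ((l - L) * (l + L + a) + (L ^ 2 + a * L - 2))%R by ring.
    rewrite HE, Rplus_0_r; apply Rmult_lt_0_compat; lra. }
  assert (E : ((l ^ 2 + a * l - 2) * (1 + 3 * b ^ 2 + r * b * (3 + b ^ 2)) ^ 2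
               = - (3 * b ^ 2 * (1 - b ^ 4)))%R).
  (* With this choice of centre the terms linear in [r] cancel, so only [r * r] enters. *)
  { transitivity (4 * b ^ 2 * (1 + b ^ 2) ^ 2 + 4 * b ^ 2 * (1 + 3 * b ^ 2)
        - 2 * (1 + 3 * b ^ 2) ^ 2 + r * r *
        (4 * (1 + b ^ 2) ^ 2 + 4 * b ^ 2 * (3 + b ^ 2) - 2 * b ^ 2 * (3 + b ^ 2) ^ 2))%R.
    - unfold l, a, end_slope, zero_of; field; split; nra.
    - rewrite Hr2; field. }
  assert (0 < (1 + 3 * b ^ 2 + r * b * (3 + b ^ 2)) ^ 2)%R by (apply pow_lt; exact HD).
  assert (0 <= 3 * b ^ 2 * (1 - b ^ 4))%R.
  { assert (0 <= b ^ 2 < 1)%R by nra.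
    apply Rmult_le_pos; [lra|]; replace (b ^ 4)%R with (b ^ 2 * b ^ 2)%R by ring; nra. }
  assert (0 < (l ^ 2 + a * l - 2) * (1 + 3 * b ^ 2 + r * b * (3 + b ^ 2)) ^ 2)%R
    by (apply Rmult_lt_0_compat; assumption).
  lra.
Qed.

Lemma end_slope_le_top_root4 (b : R) :
  (-1 < b < 1)%R -> (end_slope (4 / 5) b <= top_root4 (zero_of b))%R.
Proof.
  intros Hb; assert (HD := end_slope_denominator (4 / 5) b Hb ltac:(lra)).
  set (l := end_slope (4 / 5) b); set (a := zero_of b).
  destruct (top_root4_eq a (zero_of_bound b Hb)) as [HE _].
  assert (HL : ((1 + a ^ 2) / 2 <= top_root4 a)%R).
  { unfold top_root4; assert (H := sqrt_pos ((1 + a ^ 2) ^ 2 + 4 - 8 * a)); lra. }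
  set (L := top_root4 a) in *.
  apply Rnot_lt_le; intros Hl.
  assert (Hpos : (0 < l ^ 2 - (1 + a ^ 2) * l + 2 * a - 1)%R).
  { replace (l ^ 2 - (1 + a ^ 2) * l + 2 * a - 1)%R
      with ((l - L) * (l + L - (1 + a ^ 2)) + (L ^ 2 - (1 + a ^ 2) * L + 2 * a - 1))%R
      by ring.
    rewrite HE, Rplus_0_r; apply Rmult_lt_0_compat; lra. }
  set (D := (1 + 3 * b ^ 2 + 4 / 5 * b * (3 + b ^ 2))%R) in *.
  (* Near [b = 1] the sign argument fails: the polynomial of degree 7 below becomes negative, [l]
     having dropped under the smaller root. There [l] is compared with the vertex [(1 + a^2) / 2] of
     the quadratic instead. *)
  destruct (Rle_lt_dec b (19 / 20)) as [Hb9|Hb9].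
  - assert (E : ((l ^ 2 - (1 + a ^ 2) * l + 2 * a - 1) * (D * (1 + b ^ 2)) ^ 2
      = - ((1 - b) ^ 2 * (1 + b) / 25 *
        (1 + b * (7 + b * (36 + b * (-30 + b * (69 + b * (-81 + b * (34 - 44 * b)))))))))%R).
    { unfold l, a, end_slope, zero_of; fold D; unfold D; field; split; [nra|].
      unfold D in HD; nra. }
    assert (0 < (D * (1 + b ^ 2)) ^ 2)%R by (apply pow_lt, Rmult_lt_0_compat; nra).
    assert (0 < 1 + b * (7 + b * (36 + b * (-30 + b * (69 + b *
        (-81 + b * (34 - 44 * b)))))))%R.
    { destruct (Rle_lt_dec 0 b) as [Hb0|Hb0].
      (* Horner bounds from the inside out: each bracket has a rational lower bound on
         [[0, 19 / 20]], which is multiplied by [b] and passed on. *)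
      - assert (T : forall p m : R, (m <= p)%R -> (b * m <= b * p)%R)
          by (intros; apply Rmult_le_compat_l; assumption).
        assert (T1 := (T (34 - 44 * b) (-78 / 10) ltac:(lra))%R).
        assert (T2 := (T (-81 + b * (34 - 44 * b)) (-885 / 10) ltac:(lra))%R).
        assert (T3 := (T (69 + b * (-81 + b * (34 - 44 * b))) (-155 / 10) ltac:(lra))%R).
        assert (T4 := (T (-30 + b * (69 + b * (-81 + b * (34 - 44 * b)))) (-448 / 10)
          ltac:(lra))%R).
        assert (T5 := (T (36 + b * (-30 + b * (69 + b * (-81 + b * (34 - 44 * b)))))
          (-66 / 10) ltac:(lra))%R).
        assert (T6 := (T (7 + b * (36 + b * (-30 + b * (69 + b * (-81 + b * (34 - 44 * b))))))
          0 ltac:(lra))%R).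
        lra.
      (* In terms of [d] the only negative term is [- 7 * d], absorbed by [36 * d^2 + 1]. *)
      - set (d := (- b)%R); replace b with (- d)%R by (unfold d; ring).
        assert (Hd : (0 < d)%R) by (unfold d; lra).
        assert (0 < d ^ 3)%R by (apply pow_lt, Hd).
        assert (0 < d ^ 4)%R by (apply pow_lt, Hd).
        assert (0 < d ^ 5)%R by (apply pow_lt, Hd).
        assert (0 < d ^ 6)%R by (apply pow_lt, Hd).
        assert (0 < d ^ 7)%R by (apply pow_lt, Hd).
        assert (0 < 36 * d ^ 2 - 7 * d + 1)%R by nra.
        lra. }
    assert (0 < (1 - b) ^ 2 * (1 + b) / 25)%R.
    { assert (0 < (1 - b) ^ 2)%R by (apply pow_lt; lra). nra. }
    nra.
  - assert (E : ((l - (1 + a ^ 2) / 2) * (2 * D * (1 + b ^ 2) ^ 2)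
      = - ((1 - b) / 5 * (-11 + b * (-19 + b * (-22 + b * (-6 + b *
             (41 + b * (17 + b * 16))))))))%R).
    { unfold l, a, end_slope, zero_of; fold D; unfold D; field; split; [nra|].
      unfold D in HD; nra. }
    assert (0 < 2 * D * (1 + b ^ 2) ^ 2)%R.
    { assert (0 < (1 + b ^ 2) ^ 2)%R by (apply pow_lt; nra).
      apply Rmult_lt_0_compat; lra. }
    assert (T : forall p m : R, (0 <= m <= p)%R -> (19 / 20 * m <= b * p)%R) by (intros; nra).
    assert (T1 := (T 16 16 ltac:(lra))%R).
    assert (T2 := (T (17 + b * 16) (322 / 10) ltac:(lra))%R).
    assert (T3 := (T (41 + b * (17 + b * 16)) (715 / 10) ltac:(lra))%R).
    assert (T4 := (T (-6 + b * (41 + b * (17 + b * 16))) (619 / 10) ltac:(lra))%R).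
    assert (T5 := (T (-22 + b * (-6 + b * (41 + b * (17 + b * 16)))) (368 / 10) ltac:(lra))%R).
    assert (T6 := (T (-19 + b * (-22 + b * (-6 + b * (41 + b * (17 + b * 16)))))
      (159 / 10) ltac:(lra))%R).
    nra.
Qed.

(** A pseudohyperbolic disk with real centre is the Euclidean disk on its real diameter [[e1, e2]],
    with equation [(X - e1) * (X - e2) + Y^2 < 0]; moving the ends outwards only lowers the
    product. *)
Lemma pseudohyperbolic_disk_diameter (c r al be X Y : R) :
  (-1 < c < 1)%R -> (0 < r < 1)%R ->
  (al <= (c - r) / (1 - r * c))%R -> ((c + r) / (1 + r * c) <= be)%R ->
  pseudohyperbolic_disk c r (X, Y) -> ((X - al) * (X - be) + Y ^ 2 < 0)%R.
Proof.
  intros Hc Hr Hal Hbe [Hz Hd].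
  assert (Hrc : (-1 < r * c < 1)%R) by nra.
  assert (Hden : 1 - Cconj c * (X, Y) <> 0).
  { apply disk_denominator; [|exact Hz]; unfold unit_disk; rewrite Cmod_R.
    apply Rabs_def1; lra. }
  assert (Hd2 : ((X - c) ^ 2 + Y ^ 2 < r ^ 2 * ((1 - c * X) ^ 2 + (c * Y) ^ 2))%R).
  { unfold disk_automorphism in Hd; rewrite Cmod_div in Hd by exact Hden.
    assert (Hm := proj1 (Cmod_gt_0 _) Hden).
    assert (H : (Cmod ((X, Y) - c) < r * Cmod (1 - Cconj c * (X, Y)))%R).
    { apply (Rmult_lt_compat_r _ _ _ Hm) in Hd.
      replace (Cmod ((X, Y) - c) / Cmod (1 - Cconj c * (X, Y)) * Cmod (1 - Cconj c * (X, Y)))%R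
        with (Cmod ((X, Y) - c)) in Hd by (field; lra).
      exact Hd. }
    assert (H0 := Cmod_ge_0 ((X, Y) - c)).
    assert (H2 : (Cmod ((X, Y) - c) ^ 2 < (r * Cmod (1 - Cconj c * (X, Y))) ^ 2)%R)
      by (rewrite <- !Rsqr_pow2; apply Rsqr_incrst_1; lra).
    rewrite Rpow_mult_distr in H2.
    assert (S : forall z : C, (Cmod z ^ 2 = Re z ^ 2 + Im z ^ 2)%R).
    { intros z; unfold Cmod; rewrite pow2_sqrt; [reflexivity|].
      apply Rplus_le_le_0_compat; apply pow2_ge_0. }
    rewrite !S in H2; simpl in H2.
    replace ((X - c) ^ 2 + Y ^ 2)%R
      with ((X + - c) * ((X + - c) * 1) + (Y + - 0) * ((Y + - 0) * 1))%R by ring.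
    replace (r ^ 2 * ((1 - c * X) ^ 2 + (c * Y) ^ 2))%R
      with (r * (r * 1) * ((1 + - (c * X - - 0 * Y)) * ((1 + - (c * X - - 0 * Y)) * 1)
        + (0 + - (c * Y + - 0 * X)) * ((0 + - (c * Y + - 0 * X)) * 1)))%R by ring.
    exact H2. }
  set (e1 := ((c - r) / (1 - r * c))%R) in *; set (e2 := ((c + r) / (1 + r * c))%R) in *.
  assert (Hpos : (0 < 1 - (r * c) ^ 2)%R) by nra.
  assert (E : ((X - e1) * (X - e2) + Y ^ 2
    = ((X - c) ^ 2 + Y ^ 2 - r ^ 2 * ((1 - c * X) ^ 2 + (c * Y) ^ 2)) / (1 - (r * c) ^ 2))%R).
  { unfold e1, e2; field; repeat split; lra. }
  assert (HE : ((X - e1) * (X - e2) + Y ^ 2 < 0)%R).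
  { rewrite E; unfold Rdiv; apply Ropp_lt_cancel; rewrite Ropp_0, Ropp_mult_distr_l.
    apply Rmult_lt_0_compat; [lra | now apply Rinv_0_lt_compat]. }
  assert (He : (e1 < e2)%R).
  { assert (E' : (e2 - e1 = 2 * r * (1 - c ^ 2) / (1 - (r * c) ^ 2))%R)
      by (unfold e1, e2; field; repeat split; lra).
    assert (0 < 2 * r * (1 - c ^ 2) / (1 - (r * c) ^ 2))%R.
    { apply Rdiv_lt_0_compat; [apply Rmult_lt_0_compat; nra | exact Hpos]. }
    lra. }
  assert (HY := pow2_ge_0 Y).
  assert (HX : (e1 < X < e2)%R) by (split; apply Rnot_le_lt; intros H; nra).
  assert (0 <= (e1 - al) * (be - X))%R by (apply Rmult_le_pos; lra).
  assert (0 <= (X - e1) * (be - e2))%R by (apply Rmult_le_pos; lra).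
  nra.
Qed.

Lemma half_factor_nonneg (a : R) : (-1 < a < 1)%R -> (0 <= (1 - a ^ 2) / 2)%R.
Proof. intros Ha; nra. Qed.

Lemma form_range_disk3 (r b : R) (w : C) :
  (0 < r < 1)%R -> (r * r = 1 / 2)%R -> (-1 < b < 1)%R -> (0 <= zero_of b)%R ->
  pseudohyperbolic_disk (centre_of b) r w -> form_range 3 (zero_of b) w.
Proof.
  intros Hr Hr2 Hb Ha Hw; destruct w as [X Y].
  assert (Hb' : (-1 < - b < 1)%R) by lra.
  assert (Ha1 := zero_of_bound b Hb); assert (Hq := half_factor_nonneg _ Ha1).
  destruct (top_root3_gt (zero_of b) Ha1) as [L1 L1'].
  destruct (top_root3_gt (- zero_of b) ltac:(lra)) as [L2 L2'].
  assert (E1 := top_root3_eq (zero_of b)); assert (E2 := top_root3_eq (- zero_of b)).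
  apply (form_range_trial3 _ (top_root3 (zero_of b)) (top_root3 (- zero_of b)));
    try lra.
  apply (pseudohyperbolic_disk_diameter (centre_of b) r);
    [now apply centre_of_bound | exact Hr | | | exact Hw].
  - rewrite lower_end by assumption.
    assert (H := end_slope_le_top_root3 r (- b) Hb' Hr Hr2); rewrite zero_of_opp in H.
    assert (G := Rmult_le_compat_l _ _ _ Hq H); lra.
  - rewrite upper_end by assumption.
    assert (H := end_slope_le_top_root3 r b Hb Hr Hr2).
    assert (G := Rmult_le_compat_l _ _ _ Hq H); lra.
Qed.

Lemma form_range_disk4 (b : R) (w : C) :
  (-1 < b < 1)%R -> (0 <= zero_of b)%R ->
  pseudohyperbolic_disk (centre_of b) (4 / 5) w -> form_range 4 (zero_of b) w.
Proof.
  intros Hb Ha Hw; destruct w as [X Y].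
  assert (Hb' : (-1 < - b < 1)%R) by lra.
  assert (Ha1 := zero_of_bound b Hb); assert (Hq := half_factor_nonneg _ Ha1).
  destruct (top_root4_eq (zero_of b) Ha1) as [E1 L1].
  destruct (top_root4_eq (- zero_of b) ltac:(lra)) as [E2 L2].
  apply (form_range_trial4 _ (top_root4 (zero_of b)) (top_root4 (- zero_of b)));
    try lra.
  apply (pseudohyperbolic_disk_diameter (centre_of b) (4 / 5));
    [now apply centre_of_bound | lra | | | exact Hw].
  - rewrite lower_end by (assumption || lra).
    assert (H := end_slope_le_top_root4 (- b) Hb'); rewrite zero_of_opp in H.
    assert (G := Rmult_le_compat_l _ _ _ Hq H); lra.
  - rewrite upper_end by (assumption || lra).
    assert (H := end_slope_le_top_root4 b Hb).
    assert (G := Rmult_le_compat_l _ _ _ Hq H); lra.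
Qed.

(** * Rotation to a nonnegative zero, and conclusion *)

Lemma pseudohyperbolic_disk_rotate (c r : R) (u w : C) :
  unit_circle u -> pseudohyperbolic_disk (u * c) r w ->
  pseudohyperbolic_disk c r (Cconj u * w).
Proof.
  intros Hu [Hw Hd].
  assert (Huv : u * Cconj u = 1).
  { rewrite <- Cmod2_conj, Hu; f_equal; ring. }
  split.
  - unfold unit_disk; rewrite Cmod_mult, Cmod_conj, Hu, Rmult_1_l; exact Hw.
  - replace (disk_automorphism c (Cconj u * w))
      with (Cconj u * disk_automorphism (u * c) w).
    + rewrite Cmod_mult, Cmod_conj, Hu, Rmult_1_l; exact Hd.
    + unfold disk_automorphism, Cdiv; rewrite Cmult_conj, !Cconj_R.
      replace (1 - c * (Cconj u * w)) with (1 - Cconj u * c * w) by ring.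
      set (v := Cconj u) in *; ring [Huv].
Qed.

Lemma polar_form (a : C) : exists u, unit_circle u /\ a = u * RtoC (Cmod a).
Proof.
  destruct (Ceq_dec a 0) as [->|Ha].
  - exists 1; split; [apply Cmod_1|]; rewrite Cmod_0; ring.
  - assert (Hm := proj1 (Cmod_gt_0 a) Ha).
    assert (Hm' : RtoC (Cmod a) <> 0) by (intros H; apply RtoC_inj in H; lra).
    exists (a / RtoC (Cmod a)); split; [|field; exact Hm'].
    unfold unit_circle; rewrite Cmod_div, Cmod_R, Rabs_pos_eq by (assumption || lra).
    field; lra.
Qed.

Theorem theorem1p6 :
  forall (n : nat) (Theta : C -> C),
    unicritical_blaschke n Theta ->
    ((3 <= n)%nat ->
       exists w0 : C, unit_disk w0 /\
         forall w : C,
           pseudohyperbolic_disk w0 (1 / Rpower 2 (1 / 2))%R w ->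
           numerical_range (model_space Theta) (compressed_shift Theta) w) /\
    ((4 <= n)%nat ->
       exists w0 : C, unit_disk w0 /\
         forall w : C,
           pseudohyperbolic_disk w0 (1 / Rpower 2 (1 / 3))%R w ->
           numerical_range (model_space Theta) (compressed_shift Theta) w).
Proof.
  intros n Theta [_ [a [lambda [Ha [Hl HT]]]]].
  destruct (polar_form a) as [u [Hu Ea]].
  destruct (zero_of_surj (Cmod a) (conj (Cmod_ge_0 a) Ha)) as [b [Hb Eb]].
  rewrite <- Eb in Ea.
  assert (Hb0 : (0 <= zero_of b)%R) by (rewrite Eb; apply Cmod_ge_0).
  assert (Huv : u * Cconj u = 1).
  { rewrite <- Cmod2_conj, Hu; f_equal; ring. }
  assert (Hw0 : unit_disk (u * centre_of b)).
  { unfold unit_disk; rewrite Cmod_mult, Hu, Rmult_1_l, Cmod_R.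
    destruct (centre_of_bound b Hb); now apply Rabs_def1. }
  assert (transfer : forall m w, (3 <= n)%nat -> ((3 < m)%nat -> (4 <= n)%nat) ->
    form_range m (zero_of b) (Cconj u * w) ->
    numerical_range (model_space Theta) (compressed_shift Theta) w).
  { intros m w Hn Hm H.
    apply (form_range_rotate m (zero_of b) u _ Hu) in H.
    replace (u * (Cconj u * w)) with w in H by (rewrite Cmult_assoc, Huv; ring).
    rewrite <- Ea in H; destruct H as [x [H3 [Hx <-]]].
    apply (numerical_range_shift_form a lambda n); try assumption.
    destruct (Nat.le_gt_cases m 3); [right; auto | left; auto]. }
  split; intros Hn; exists (u * centre_of b); (split; [exact Hw0|]); intros w Hw.
  - set (r := (1 / Rpower 2 (1 / 2))%R) in *.
    assert (Hp : (Rpower 2 (1 / 2) * Rpower 2 (1 / 2) = 2)%R).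
    { rewrite <- Rpower_plus; replace (1 / 2 + 1 / 2)%R with 1%R by field.
      apply Rpower_1; lra. }
    assert (Hp0 : (0 < Rpower 2 (1 / 2))%R) by apply exp_pos.
    assert (Hr0 : (0 < r)%R) by (apply Rdiv_lt_0_compat; lra).
    assert (Hr2 : (r * r = 1 / 2)%R).
    { rewrite <- Hp; unfold r; field; lra. }
    apply (transfer 3%nat w); [exact Hn | lia|].
    apply (form_range_disk3 r); try assumption; [nra|].
    now apply pseudohyperbolic_disk_rotate.
  - apply (transfer 4%nat w); [lia | auto|].
    apply form_range_disk4; try assumption.
    apply pseudohyperbolic_disk_rotate; [exact Hu|].
    destruct Hw as [Hw Hd]; split; [exact Hw|].
    apply Rlt_le_trans with (1 := Hd).
    set (p := Rpower 2 (1 / 3)).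
    assert (Hp : (p * p * p = 2)%R).
    { unfold p; rewrite <- !Rpower_plus; replace (1 / 3 + 1 / 3 + 1 / 3)%R with 1%R by field.
      apply Rpower_1; lra. }
    assert (Hp0 : (0 < p)%R) by apply exp_pos.
    (* [(5 / 4)^3 = 125 / 64 < 2]. *)
    assert (Hp1 : (5 / 4 <= p)%R) by (apply Rnot_lt_le; intros H; nra).
    apply (Rmult_le_reg_r p); [exact Hp0|].
    replace (1 / p * p)%R with 1%R by (field; lra); lra.
Qed.
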